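(* Let $\phi$ be a Drinfeld $A$-module of rank $r\ge2$ over $F$ and let $0\neq\mathfrak n\in A$. Assume the characteristic $p$ of $F$ does not divide $r$, and let $\mathfrak p\in\mathcal P(\phi)$ be a prime not dividing $\mathfrak n$. Then $\mathfrak p$ splits completely in the Galois extension $F(\phi[\mathfrak n])/F$ if and only if $$a_{\mathfrak p,1}+r\equiv0\pmod{\mathfrak n}\quad\text{and}\quad \mathfrak b_{\mathfrak p,1}\equiv0\pmod{\mathfrak n}.$$
   Context: $A=\mathbb F_q[T]$, $F=\mathbb F_q(T)$, $p=\mathrm{char}\,\mathbb F_q$. Primes of $A$ are nonzero prime ideals identified with monic generators. A Drinfeld $A$-module $\phi$ of rank $r$ over $F$ is a ring homomorphism $A\to F\{\tau\}$ ($\tau c=c^q\tau$) with $\phi_T=T+g_1\tau+\dots+g_r\tau^r$, $g_r\ne0$. For $a\in A$ with $\phi_a=\sum_i c_i\tau^i$, $\phi[a]$ is the set of roots in $F^{\mathrm{alg}}$ of $\phi_a(x)=\sum_i c_ix^{q^i}$, and $F(\phi[a])$ is the splitting field of $\phi_a(x)$ over $F$. $\mathcal P(\phi)$ is the set of primes $\mathfrak p$ with $\mathrm{ord}_\mathfrak p(g_i)\ge0$ for all $i$ and $\mathrm{ord}_\mathfrak p(g_r)=0$; for such $\mathfrak p$ of degree $d$, $\phi\otimes\mathbb F_\mathfrak p$ is the reduced Drinfeld module over $\mathbb F_\mathfrak p=A/\mathfrak p$, $\mathcal E_\mathfrak p=\mathrm{End}_{\mathbb F_\mathfrak p}(\phi\otimes\mathbb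 F_\mathfrak p)$ (centralizer of the image of $A$ in $\mathbb F_\mathfrak p\{\tau\}$), $\pi_\mathfrak p=\tau^d\in\mathcal E_\mathfrak p$, and $P_\mathfrak p(X)=X^r+a_{\mathfrak p,1}X^{r-1}+\dots+a_{\mathfrak p,r}\in A[X]$ is the minimal polynomial of $\pi_\mathfrak p$ over $F$ (it has degree $r$). $A[\pi_\mathfrak p]\subset\mathcal E_\mathfrak p$ are $A$-orders of rank $r$ and $\mathcal E_\mathfrak p/A[\pi_\mathfrak p]\cong A/\mathfrak b_{\mathfrak p,1}\times\cdots\times A/\mathfrak b_{\mathfrak p,r-1}$ with uniquely determined monic $\mathfrak b_{\mathfrak p,1}\mid\cdots\mid\mathfrak b_{\mathfrak p,r-1}$ (the refined index). *)

(* Defs.v *)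
From HB Require Import structures.
From mathcomp Require Import all_boot all_order all_algebra all_field.
Set Implicit Arguments. Unset Strict Implicit. Unset Printing Implicit Defensive.
Import Order.TTheory GRing.Theory Num.Theory.
Local Open Scope ring_scope.
Notation "x %:F" := (@tofrac _ x) : ring_scope.

(* ---------- Twisted (skew) polynomials R{tau}, tau c = c^q tau ----------
   An element  sum_i c_i tau^i  is represented by the ordinary polynomial
   sum_i c_i 'X^i : {poly R} (coefficient i = coefficient of tau^i);
   only the multiplication is twisted. *)
Section Twisted.
Variable (R : comNzRingType) (q : nat).

Definition tmul (f g : {poly R}) : {poly R} :=
  \sum_(i < size f) \sum_(j < size g) (f`_i * g`_j ^+ (q ^ i)) *: 'X^(i + j).

Definition tpow (f : {poly R}) (n : nat) : {poly R} := iter n (tmul f) 1.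

Definition qpoly_of (c : {poly R}) : {poly R} :=
  \sum_(i < size c) c`_i *: 'X^(q ^ i).
End Twisted.

Section Drinfeld.
Variable K : finFieldType.
Local Notation A := {poly K}.
Local Notation F := {fraction {poly K}}.
Local Notation q := #|K|.

(* The A-action attached to phi_T = g in R{tau}, where iota : F_q -> R is the
   structure map:  phi_a = sum_i a_i phi_T^i  for  a = sum_i a_i T^i. *)
Definition dact (R : comNzRingType) (iota : K -> R) (g : {poly R}) (a : A)
  : {poly R} :=
  \sum_(i < size a) iota a`_i *: tpow q g i.

Definition iotaF (c : K) : F := (c%:P)%:F.

Definition phi_poly (g : {poly F}) (a : A) : {poly F} :=
  qpoly_of q (dact iotaF g a).

Definition p_integral (p : A) (x : F) : Prop :=
  exists a b : A, ~~ (p %| b) /\ x = a%:F / b%:F.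
Definition p_unit (p : A) (x : F) : Prop :=
  exists a b : A, ~~ (p %| a) /\ ~~ (p %| b) /\ x = a%:F / b%:F.

Definition good_prime (p : A) (g : {poly F}) (r : nat) : Prop :=
  (forall i, p_integral p g`_i) /\ p_unit p g`_r.

Definition Fp (p : A) (mi : monic_irreducible_poly p) : finFieldType :=
  {poly %/ p with mi}.
Definition redA (p : A) (mi : monic_irreducible_poly p) (a : A) : Fp mi :=
  in_qpoly p a.
Definition iotaP (p : A) (mi : monic_irreducible_poly p) (c : K) : Fp mi :=
  redA mi c%:P.

Definition red_rel (p : A) (mi : monic_irreducible_poly p) (x : F) (y : Fp mi)
  : Prop :=
  exists a b : A, ~~ (p %| b) /\ x = a%:F / b%:F /\ y * redA mi b = redA mi a.

Definition in_End (p : A) (mi : monic_irreducible_poly p) (gbar : {poly Fp mi})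
  (u : {poly Fp mi}) : Prop :=
  forall a : A, tmul q u (dact (@iotaP p mi) gbar a)
              = tmul q (dact (@iotaP p mi) gbar a) u.

Definition pi_p (p : A) (mi : monic_irreducible_poly p) : {poly Fp mi} :=
  'X^((size p).-1).

Definition eval_pi (p : A) (mi : monic_irreducible_poly p) (gbar : {poly Fp mi})
  (Q : {poly A}) : {poly Fp mi} :=
  \sum_(i < size Q)
     tmul q (dact (@iotaP p mi) gbar Q`_i) (tpow q (pi_p mi) i).

Definition is_minpoly_pi (p : A) (mi : monic_irreducible_poly p)
  (gbar : {poly Fp mi}) (P : {poly A}) : Prop :=
  [/\ P \is monic, eval_pi gbar P = 0 &
      (forall Q : {poly A}, Q != 0 -> eval_pi gbar Q = 0 -> (size P <= size Q)%N)].

Definition in_Api (p : A) (mi : monic_irreducible_poly p) (gbar : {poly Fp mi})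
  (u : {poly Fp mi}) : Prop :=
  exists Q : {poly A}, u = eval_pi gbar Q.

(* Refined index: b_0 | b_1 | ... | b_(r-2) monic and
   E_p / A[pi_p] ~= A/b_0 x ... x A/b_(r-2) as A-modules, expressed by an
   A-linear surjection f : E_p -> prod_i A/b_i with kernel A[pi_p]
   (f u i is a representative of the i-th component). *)
Definition refined_index (p : A) (mi : monic_irreducible_poly p)
  (gbar : {poly Fp mi}) (r : nat) (b : nat -> A) : Prop :=
  [/\ (forall i, (i < r.-1)%N -> b i \is monic),
      (forall i, (i.+1 < r.-1)%N -> b i %| b i.+1) &
      exists f : {poly Fp mi} -> nat -> A,
        [/\ (forall u v i, in_End gbar u -> in_End gbar v -> (i < r.-1)%N ->
              b i %| f (u + v) i - (f u i + f v i)),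
            (forall a u i, in_End gbar u -> (i < r.-1)%N ->
              b i %| f (tmul q (dact (@iotaP p mi) gbar a) u) i - a * f u i),
            (forall c : nat -> A, exists2 u, in_End gbar u &
              forall i, (i < r.-1)%N -> b i %| f u i - c i) &
            forall u, in_End gbar u ->
              ((forall i, (i < r.-1)%N -> b i %| f u i) <-> in_Api gbar u)]].

Section Ext.
Variable L : fieldExtType F.

Definition embA (a : A) : L := (a%:F)%:A.

Definition intA (x : L) : Prop :=
  exists Q : {poly A}, Q \is monic /\ root (map_poly embA Q) x.

(* nonzero-agnostic prime ideal of B (as a subset of L) *)
Definition prime_ideal_B (P : L -> Prop) : Prop :=
  [/\ (forall x, P x -> intA x) /\ P 0,
      (forall x y, P x -> P y -> P (x + y)),
      (forall x y, intA x -> P y -> P (x * y)),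
      ~ P 1 &
      forall x y, intA x -> intA y -> P (x * y) -> P x \/ P y].

Definition in_sq (P : L -> Prop) (x : L) : Prop :=
  exists s : seq (L * L), (forall z, z \in s -> P z.1 /\ P z.2) /\
                          x = \sum_(z <- s) z.1 * z.2.

(* p splits completely in L: every prime P of B above p has
   residue degree 1 (B/P = A/p) and ramification index 1 (p notin P^2). *)
Definition splits_completely (p : A) : Prop :=
  forall P, prime_ideal_B P -> P (embA p) ->
    (forall x, intA x -> exists a : A, P (x - embA a)) /\ ~ in_sq P (embA p).
End Ext.

End Drinfeld.

(* Main.v *)
Require Import Defs.
From HB Require Import structures.
From mathcomp Require Import all_boot all_order all_algebra all_field.
From mathcomp Require Import all_fingroup all_solvable ring.
From mathcomp Require classical_sets.
Set Implicit Arguments. Unset Strict Implicit. Unset Printing Implicit Defensive.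
Import GRing.Theory.
Local Open Scope ring_scope.

(** Write k = A/p, S = k{tau}, pi = tau^d, E for the centralizer of phi(A) in S,
    and consider the condition
      (C)  pi = 1 + phi_n u for some u in E.

    As p does not divide n, the additive polynomial phi_n(x) is separable modulo
    p. Right division in S shows that (C) says that it divides x^(q^d) - x, i.e.
    splits over k. If it does, then for a prime P over p the roots z of phi_n(x)
    are congruent modulo P to elements a_z of A, pairwise incongruent; the
    square of the product of all a_z - z' with z <> z' is prime to P and
    annihilated modulo p^2 by each of its other conjugates, so that traces
    against it prove that P has residue degree 1 and is unramified. Conversely
    a prime of residue degree 1 makes phi_n(x) split over k.

    S is free of rank r over k[T], where k acts on the left and T by right
    multiplication by phi_T. The characteristic polynomial of pi on S has
    coefficients in A, because tau acts semilinearly, and its constant term has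
    degree d; as p divides the constant term of the minimal polynomial of pi,
    the two polynomials coincide. Comparing traces, pi = phi_a + phi_n u
    with u in E forces a_1 + r a = 0 modulo n.

    If (C) holds then the elements phi_n^(i-1) u^i (0 < i < r) generate a
    submodule (A/n)^(r-1) of E/A[pi], whence n | b_1. If n | b_1, lifting
    generators of E/A[pi] to e_i and expanding b_i e_i in powers of pi yields a
    square matrix that is injective, hence surjective, on (A/n)^(r-1); therefore
    pi = phi_a + phi_n u with u in E, and r (a - 1) = 0 modulo n by the trace
    relation. *)

(** * Twisted polynomials *)

Lemma poly_mono_ind (R : nzRingType) (P : {poly R} -> Prop) :
  P 0 -> (forall f g, P f -> P g -> P (f + g)) ->
  (forall c i, P (c *: 'X^i)) -> forall f, P f.
Proof.
move=> P0 PD PX f; rewrite -[f]coefK poly_def.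
by apply: (big_ind P) => // i _; apply: PX.
Qed.

Section LinearExtension.
Variables (R : nzRingType) (V : lmodType R) (z : nat -> V).

(** The linear extension of ['X^i |-> z i]. Twisted multiplication, the additive polynomial
    [qpoly_of] and the action of [k[T]] are all of this form. *)
Definition lin (f : {poly R}) : V := \sum_(i < size f) f`_i *: z i.

Lemma linE m (f : {poly R}) : (size f <= m)%N -> lin f = \sum_(i < m) f`_i *: z i.
Proof.
move=> le; rewrite /lin -!(big_mkord xpredT (fun i => f`_i *: z i)).
rewrite [RHS](@big_cat_nat _ _ _ (size f)) //= [X in _ + X]big1_seq ?addr0 // => i.
by rewrite mem_index_iota => /and3P [_ h _]; rewrite nth_default ?scale0r.
Qed.

Lemma lin_is_linear : linear lin.
Proof.
move=> c f g; set m := maxn (size f) (size g).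
have sf : (size f <= m)%N by rewrite leq_maxl.
have sg : (size g <= m)%N by rewrite leq_maxr.
have s : (size (c *: f + g)%R <= m)%N.
  rewrite (leq_trans (size_polyD _ _)) // geq_max sg andbT.
  exact: leq_trans (size_scale_leq _ _) sf.
rewrite (linE sf) (linE sg) (linE s) scaler_sumr -big_split /=.
by apply: eq_bigr => i _; rewrite coefD coefZ scalerDl scalerA.
Qed.
HB.instance Definition _ :=
  GRing.isLinear.Build R {poly R} V _ lin lin_is_linear.

Lemma linXn c i : lin (c *: 'X^i) = c *: z i.
Proof.
rewrite linearZ /= (@linE i.+1) ?size_polyXn // big_ord_recr /= coefXn eqxx.
by rewrite scale1r big1 ?add0r // => j _; rewrite coefXn ltn_eqF ?scale0r.
Qed.
End LinearExtension.

Section SkewPolynomials.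
Variables (K : finFieldType) (R : fieldType) (iota : {rmorphism K -> R}).
Local Notation q := #|K|.

Lemma card_pnat : [pchar R].-nat q.
Proof.
have [p pr ch] := finPcharP K.
have := fin_ring_pchar_abelem ch; move/abelem_pgroup; rewrite /pgroup cardsT.
apply: sub_in_pnat => l _; rewrite inE => /eqP ->.
by rewrite (rmorph_pchar iota).
Qed.

(* The ring morphism argument is what makes [x |-> x ^+ (q ^ i)] additive. *)
Definition frobenius of {rmorphism K -> R} := fun (i : nat) (x : R) => x ^+ (q ^ i).
Local Notation frob := (frobenius iota).

Lemma card_gt1 : (1 < q)%N.
Proof. exact: finNzRing_gt1. Qed.

Lemma pnat_exp i : [pchar R].-nat (q ^ i)%N.
Proof. by rewrite pnatX card_pnat. Qed.

Lemma expq_gt0 i : (0 < q ^ i)%N.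
Proof. by rewrite expn_gt0 (ltnW card_gt1). Qed.

Lemma frob_zmod i : zmod_morphism (frob i).
Proof.
have D : {morph frob i : x y / x + y} by move=> x y; rewrite /frobenius exprDn_pchar ?pnat_exp.
move=> x y; apply: (addIr (frob i y)).
by rewrite -D !subrK.
Qed.
Lemma frob_monoid i : monoid_morphism (frob i).
Proof. by split; [apply: expr1n | move=> x y; apply: exprMn]. Qed.
HB.instance Definition _ i := GRing.isZmodMorphism.Build R R (frob i) (frob_zmod i).
HB.instance Definition _ i := GRing.isMonoidMorphism.Build R R (frob i) (frob_monoid i).

Lemma frobD i j x : frob i (frob j x) = frob (i + j) x.
Proof. by rewrite /frobenius -exprM -expnD addnC. Qed.

Lemma frob_iota i c : frob i (iota c) = iota c.
Proof.
elim: i => [|i IH]; first by rewrite /frobenius expn0 expr1.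
by rewrite -add1n -frobD IH /frobenius expn1 -rmorphXn expf_card.
Qed.

Lemma map_frob0 (f : {poly R}) : map_poly (frob 0) f = f.
Proof. by apply/polyP => i; rewrite coef_map /= /frobenius expn0 expr1. Qed.

(** Left multiplication by [tau^i] twists the coefficients of [g] by a power of Frobenius and shifts
    them by [i]. *)
Lemma tmulE (f g : {poly R}) :
  tmul q f g = lin (fun i => map_poly (frob i) g * 'X^i) f.
Proof.
rewrite /tmul /lin; apply: eq_bigr => i _.
rewrite /map_poly poly_def.
rewrite mulr_suml scaler_sumr; apply: eq_bigr => j _.
by rewrite -scalerAl scalerA -exprD addnC.
Qed.

Lemma tmulXn (c : R) i (g : {poly R}) :
  tmul q (c *: 'X^i) g = c *: (map_poly (frob i) g * 'X^i).
Proof. by rewrite tmulE linXn. Qed.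

Lemma tmulDl (f g h : {poly R}) : tmul q (f + g) h = tmul q f h + tmul q g h.
Proof. by rewrite !tmulE linearD. Qed.

Lemma tmulDr (f g h : {poly R}) : tmul q f (g + h) = tmul q f g + tmul q f h.
Proof.
rewrite !tmulE /lin -big_split; apply: eq_bigr => i _ /=.
by rewrite rmorphD mulrDl scalerDr.
Qed.

Lemma tmul0l (f : {poly R}) : tmul q 0 f = 0.
Proof. by rewrite tmulE linear0. Qed.
Lemma tmul0r (f : {poly R}) : tmul q f 0 = 0.
Proof. by apply: (addrI (tmul q f 0)); rewrite -tmulDr !addr0. Qed.

Lemma tmulXnXn (c b : R) i j :
  tmul q (c *: 'X^i) (b *: 'X^j) = (c * frob i b) *: 'X^(i + j).
Proof. by rewrite tmulXn map_polyZ map_polyXn -scalerAl scalerA -exprD addnC. Qed.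

Lemma tmulA : associative (tmul (R := R) q).
Proof.
move=> f g h; elim/poly_mono_ind: f => [|f f' Hf Hf'|c i]; first by rewrite !tmul0l.
  by rewrite !tmulDl Hf Hf'.
elim/poly_mono_ind: g => [|g g' Hg Hg'|b j]; first by rewrite tmul0r tmul0l tmul0r.
  by rewrite tmulDl !tmulDr tmulDl Hg Hg'.
elim/poly_mono_ind: h => [|h h' Hh Hh'|a k]; first by rewrite !tmul0r.
  by rewrite !tmulDr Hh Hh'.
by rewrite !tmulXnXn rmorphM /= frobD mulrA addnA.
Qed.

Lemma tmul1l : left_id 1 (tmul (R := R) q).
Proof.
move=> f; have -> : 1 = 1 *: 'X^0 :> {poly R} by rewrite scale1r expr0.
by rewrite tmulXn map_frob0 mulr1 scale1r.
Qed.

Lemma tmul1r : right_id 1 (tmul (R := R) q).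
Proof.
elim/poly_mono_ind => [|f f' Hf Hf'|c i]; first by rewrite tmul0l.
  by rewrite tmulDl Hf Hf'.
by rewrite tmulXn rmorph1 mul1r.
Qed.

(* The type is an alias of [{poly R}]: [f * g] in [skewpoly] is convertible to
   [tmul q f g]. *)
Definition skewpoly of {rmorphism K -> R} : Type := {poly R}.
HB.instance Definition _ := GRing.Lmodule.on (skewpoly iota).
HB.instance Definition _ := GRing.Zmodule_isNzRing.Build (skewpoly iota)
  tmulA tmul1l tmul1r tmulDl tmulDr (oner_neq0 {poly R}).

Local Notation S := (skewpoly iota).
Local Notation size_ := (fun f : S => size (f : {poly R})).

Lemma skewM (f g : S) : f * g = tmul q f g. Proof. by []. Qed.
Lemma skewX (f : S) i : f ^+ i = tpow q f i.
Proof. by elim: i => [|i IH]; [rewrite expr0 | rewrite exprS IH]. Qed.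
Lemma skewZ c (f : S) : c *: f = (c%:P : S) * f.
Proof.
have -> : c%:P = c *: 'X^0 :> {poly R} by rewrite expr0 alg_polyC.
by rewrite skewM tmulXn map_frob0 mulr1.
Qed.
Lemma scalerAlS c (f g : S) : c *: (f * g : S) = (c *: f : S) * g.
Proof. by rewrite !skewZ mulrA. Qed.

Lemma coef0_skewM (f g : S) : (f * g : {poly R})`_0 = (f : {poly R})`_0 * (g : {poly R})`_0.
Proof.
rewrite skewM; move: (f) (g) => {f g} /= f g.
elim/poly_mono_ind: f => [|f f' Hf Hf'|c i]; first by rewrite tmul0l coef0 mul0r.
  by rewrite tmulDl !coefD mulrDl Hf Hf'.
rewrite tmulXn !coefZ coefMXn coefXn; case: i => [|i] /=; last by rewrite !mulr0 mul0r.
by rewrite map_frob0 mulr1.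
Qed.

Lemma size_frob i (f : {poly R}) : size (map_poly (frob i) f) = size f.
Proof. exact: size_map_poly. Qed.

(** Frobenius twists preserve the degree of [g], so only the leading term of [f] reaches the top
    degree and nothing cancels. *)
Lemma size_skewM (f g : S) : f != 0 -> g != 0 ->
  size_ (f * g) = (size_ f + size_ g).-1.
Proof.
rewrite skewM; move: (f) (g) => {f g} /= f g f0 g0.
have sf : size f = (size f).-1.+1 by rewrite prednK ?lt0n ?size_poly_eq0.
have sg : (0 < size g)%N by rewrite lt0n size_poly_eq0.
have le : (size f <= (size f).-1.+1)%N by rewrite -sf.
rewrite tmulE (linE _ le) big_ord_recr /=.
have top : size (f`_(size f).-1 *: (map_poly (frob (size f).-1) g * 'X^((size f).-1)))
   = (size f + size g).-1.
  rewrite size_scale; last by rewrite -lead_coefE lead_coef_eq0.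
  rewrite size_mulXn ?size_frob; first by rewrite sf.
  by rewrite -size_poly_eq0 size_frob size_poly_eq0.
rewrite addrC size_polyDl top //.
rewrite (leq_ltn_trans (size_sum _ _ _)) //.
have -> : (size f + size g).-1 = ((size f).-1 + size g)%N by rewrite {1}sf.
apply: (big_ind (fun m => (m < (size f).-1 + size g)%N)) => [|a b ha hb|i _].
- by rewrite addn_gt0 sg orbT.
- by rewrite gtn_max ha.
rewrite (leq_ltn_trans (size_scale_leq _ _)) //.
rewrite (leq_ltn_trans (size_polyMleq _ _)) // size_frob size_polyXn addnS /=.
by rewrite addnC ltn_add2r.
Qed.

Lemma skew_mulf_eq0 (f g : S) : (f * g == 0) = (f == 0) || (g == 0).
Proof.
have [->|f0] := eqVneq f 0; first by rewrite mul0r eqxx.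
have [->|g0] := eqVneq g 0; first by rewrite mulr0 eqxx.
apply/eqP => h; have := size_skewM f0 g0; rewrite h size_poly0.
have : (0 < size_ f)%N by rewrite lt0n size_poly_eq0.
have : (0 < size_ g)%N by rewrite lt0n size_poly_eq0.
by case: (size_ f) => // a; case: (size_ g) => // b; rewrite addnS addSn.
Qed.

Lemma skew_mulrI (f : S) : f != 0 -> injective ( *%R f).
Proof.
move=> f0 g h /eqP; rewrite -subr_eq0 -mulrBr skew_mulf_eq0 (negPf f0) /=.
by rewrite subr_eq0 => /eqP.
Qed.
Lemma skew_mulIr (f : S) : f != 0 -> injective ( *%R^~ f).
Proof.
move=> f0 g h /eqP; rewrite -subr_eq0 -mulrBl skew_mulf_eq0 (negPf f0) orbF.
by rewrite subr_eq0 => /eqP.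
Qed.

Lemma qpolyE (f : {poly R}) : qpoly_of q f = lin (fun i => 'X^(q ^ i)) f.
Proof. by []. Qed.

Lemma skewXnXn (c b : R) i j :
  (c *: 'X^i : S) * (b *: 'X^j : S) = (c * frob i b) *: 'X^(i + j).
Proof. by rewrite skewM tmulXnXn. Qed.

(** Additivity in [f] reduces to [f = c tau^i]; then the [q ^ i]-th power is additive in [g], which
    reduces to monomials. *)
Lemma qpoly_comp (f g : S) :
  qpoly_of q (f * g) = qpoly_of q f \Po qpoly_of q g.
Proof.
rewrite skewM !qpolyE; move: (f) (g) => {f g} /= f g.
elim/poly_mono_ind: f => [|f f' Hf Hf'|c i].
- by rewrite tmul0l !linear0.
- by rewrite tmulDl !linearD /= Hf Hf'.
rewrite tmulXn linXn comp_polyZ comp_Xn_poly linearZ /=; congr (_ *: _).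
elim/poly_mono_ind: g => [|g g' Hg Hg'|b j].
- by rewrite rmorph0 mul0r linear0 expr0n eqn0Ngt expq_gt0.
- rewrite rmorphD mulrDl !linearD /= Hg Hg' exprDn_pchar //.
  by have := pnat_exp i; apply: sub_in_pnat => l _; rewrite pchar_poly.
rewrite map_polyZ map_polyXn -scalerAl -exprD !linXn exprZn; congr (_ *: _).
by rewrite -exprM -expnD addnC.
Qed.

(** * The ring morphism [phi] from [A] to twisted polynomials *)

Section DrinfeldAction.
Variable g : S.

Lemma iotaC_monoid : monoid_morphism (fun c : K => (iota c)%:P : S).
Proof.
split=> [|x y]; first by rewrite rmorph1.
by rewrite rmorphM -skewZ -mul_polyC polyCM.
Qed.
Lemma iotaC_zmod : zmod_morphism (fun c : K => (iota c)%:P : S).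
Proof. by move=> x y; rewrite rmorphB polyCB. Qed.
Definition iotaC (c : K) : S := (iota c)%:P.
HB.instance Definition _ := GRing.isZmodMorphism.Build K S iotaC iotaC_zmod.
HB.instance Definition _ := GRing.isMonoidMorphism.Build K S iotaC iotaC_monoid.

(** Constants of [K] are fixed by Frobenius and so commute with [tau]. This makes evaluation at [g]
    a ring morphism. *)
Lemma iotaC_comm c (f : S) : GRing.comm f (iotaC c).
Proof.
rewrite /GRing.comm /iotaC -skewZ !skewM; move: f; rewrite /skewpoly => f.
elim/poly_mono_ind: f => [|f f' Hf Hf'|b j].
- by rewrite tmul0l scaler0.
- by rewrite tmulDl Hf Hf' scalerDr.
by rewrite -[(iota c)%:P]mulr1 mul_polyC -(expr0 'X) tmulXnXn frob_iota addn0 scalerA mulrC.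
Qed.

Lemma iotaC_commr : commr_rmorph iotaC g.
Proof. by move=> c; apply: iotaC_comm. Qed.

Definition phi : {poly K} -> S := horner_morph iotaC_commr.
HB.instance Definition _ := GRing.RMorphism.on phi.

Lemma phiE (a : {poly K}) : phi a = dact iota g a.
Proof.
rewrite /phi /horner_morph /dact horner_coef size_map_poly.
apply: eq_bigr => i _; rewrite coef_map skewX /= /iotaC -skewZ //.
Qed.

Lemma phi_X : phi 'X = g. Proof. exact: horner_morphX. Qed.
Lemma phi_C c : phi c%:P = iotaC c. Proof. exact: horner_morphC. Qed.

(** The constant coefficient is multiplicative. It carries the structure map of [A] and decides the
    separability of [phi_a(x)]. *)
Lemma coef0_phi a : (phi a : {poly R})`_0 = (map_poly iota a).[(g : {poly R})`_0].
Proof.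
elim/poly_ind: a => [|a c IH]; first by rewrite !rmorph0 coef0 horner0.
rewrite !rmorphD !rmorphM /= phi_X phi_C map_polyX map_polyC /= hornerMXaddC.
by rewrite coefD coef0_skewM IH coefC.
Qed.

Lemma size_phi r a : size (g : {poly R}) = r.+1 -> (0 < r)%N -> a != 0 ->
  size (phi a : {poly R}) = (r * (size a).-1).+1.
Proof.
move=> sg r0; elim/poly_ind: a => [|a c IH]; first by rewrite eqxx.
have [->|a0] := eqVneq a 0.
  rewrite mul0r add0r polyC_eq0 => c0; rewrite phi_C size_polyC c0 /iotaC.
  by rewrite size_polyC fmorph_eq0 c0 muln0.
rewrite rmorphD rmorphM /= phi_X phi_C => _.
have g0 : g != 0 by rewrite -size_poly_eq0 sg.
have pa0 : phi a != 0 by rewrite -size_poly_eq0 IH.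
have sa : (0 < size a)%N by rewrite lt0n size_poly_eq0.
have s1 := size_skewM pa0 g0; rewrite IH // sg addSn in s1.
rewrite size_polyDl s1 /=; last first.
  by rewrite (leq_ltn_trans (size_polyC_leq1 _)) // addnS ltnS addn_gt0 r0 orbT.
rewrite size_MXaddC (negPf a0) /= addnS; congr _.+1.
by rewrite addnC -mulnS prednK.
Qed.

Lemma phi_inj r : size (g : {poly R}) = r.+1 -> (0 < r)%N -> injective phi.
Proof.
move=> sg r0; apply: raddf_inj => a; apply: contra_eq => a0.
by rewrite -size_poly_eq0 (size_phi sg r0 a0).
Qed.
End DrinfeldAction.
End SkewPolynomials.

(** * The motive of a Drinfeld module *)

Lemma monic_dvd_const (R : idomainType) (Q W : {poly R}) (c : R) :
  Q \is monic -> (1 < size Q)%N -> Q * W = c%:P -> c = 0.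
Proof.
move=> mQ sQ h; have [W0|W0] := eqVneq W 0.
  by move: h; rewrite W0 mulr0 => /esym/eqP; rewrite polyC_eq0 => /eqP.
have := size_polyC_leq1 c; rewrite -h size_monicM // leqNgt => /negP [].
have : (0 < size W)%N by rewrite lt0n size_poly_eq0.
by case: (size Q) sQ => [|[|m]] // _; case: (size W) => // k _; rewrite addnS.
Qed.

(* Modulo [Q], the matrix [Q - Q(N)] becomes [- Q(N)], and its determinant is a
   multiple of [char_poly N]. *)
Lemma det_horner_mx_eq0 (R : idomainType) m (N : 'M[R]_m.+1) (Q W : {poly R}) :
  Q \is monic -> (1 < size Q)%N -> char_poly N = Q * W ->
  \det (horner_mx N Q) = 0.
Proof.
move=> mQ sQ dv; set M := horner_mx N Q.
have [B hB] : exists B : 'M[{poly R}]_m.+1,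
    Q%:M - map_mx polyC M = B *m char_poly_mx N.
  (* Over the ring of matrices, [N] is a root of [Q - Q(N)]; the factor theorem there is transported
     to matrices of polynomials. *)
  have [f [[f' fK f'K] fZ fC _]] := mx_poly_ring_isom R m.
  have : root (map_poly scalar_mx Q - M%:P) N.
    by rewrite rootE hornerD hornerN hornerC /M /horner_mx /horner_morph subrr.
  case/factor_theorem => B' hB'; exists (f' B').
  apply: (can_inj fK); rewrite rmorphB fZ fC hB' rmorphM /= f'K.
  by rewrite /char_poly_mx rmorphB fC fZ map_polyX.
have h1 : \det (Q%:M - map_mx polyC M) = char_poly M \Po Q.
  rewrite /char_poly -[RHS]/((comp_poly Q) _) -det_map_mx; congr (\det _).
  apply/matrixP => i j; rewrite !mxE /= comp_polyB comp_polyC.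
  by case: (i == j); rewrite ?mulr1n ?mulr0n ?comp_polyX ?comp_poly0.
have h2 : Q * (\det B * W) = char_poly M \Po Q.
  by rewrite -h1 hB det_mulmx -[\det (char_poly_mx N)]/(char_poly N) dv mulrCA.
have [V hV] : exists V, char_poly M \Po Q = Q * V + ((char_poly M)`_0)%:P.
  elim/poly_ind: (char_poly M) => [|f c [V IH]].
    by exists 0; rewrite comp_poly0 mulr0 coef0 addr0.
  exists (f \Po Q); rewrite comp_poly_MXaddC coefD coefMX coefC add0r mulrC //.
have /monic_dvd_const : Q * (\det B * W - V) = ((char_poly M)`_0)%:P.
  by rewrite mulrBr h2 hV addrAC subrr add0r.
move=> /(_ mQ sQ); rewrite char_poly_det => /eqP.
by rewrite mulf_eq0 signr_eq0 /= => /eqP.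
Qed.

Section Motive.
Variables (K k : finFieldType) (iota : {rmorphism K -> k}).
Local Notation q := #|K|.
Local Notation S := (skewpoly iota).
Local Notation frob := (frobenius iota).
Local Notation A := {poly K}.
Local Notation kT := {poly k}.
Variables (r' d : nat) (g : skewpoly iota).
Local Notation r := r'.+1.
Hypothesis card_k : #|k| = (q ^ d)%N.
Hypothesis sg : size (g : {poly k}) = r.+1.
Local Notation phi := (phi g).
Local Notation gc i := ((g : {poly k})`_i).

Definition tau (i : nat) : S := 'X^i : {poly k}.
Definition sigma : kT -> kT := map_poly (frob 1).
HB.instance Definition _ := GRing.RMorphism.on sigma.

Lemma g_lead : gc r != 0.
Proof.
have -> : gc r = lead_coef (g : {poly k}) by rewrite lead_coefE sg.
by rewrite lead_coef_eq0 -size_poly_eq0 sg.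
Qed.

Lemma tauZ i c (u : S) : tau i * (c *: u : S) = frob i c *: (tau i * u : S).
Proof.
have tE : tau i = 1 *: 'X^i :> {poly k} by rewrite scale1r.
rewrite !skewM tE !(tmulXn iota) map_polyZ /= -scalerAl !scalerA.
by rewrite mulrC.
Qed.

Lemma tauD i j : tau (i + j) = tau i * tau j.
Proof.
have tE l : tau l = (1 *: 'X^l : {poly k}) :> S by rewrite scale1r.
by rewrite (tE i) (tE j) skewXnXn rmorph1 mulr1 -(tE (i + j)%N).
Qed.

(** As [k] has [q ^ d] elements, the [d]-th iterate of Frobenius is trivial on [k]. *)
Lemma tau_d_central (u : S) : tau d * u = u * tau d.
Proof.
have tE l : tau l = (1 *: 'X^l : {poly k}) :> S by rewrite scale1r.
have fd (x : k) : frob d x = x by rewrite /frobenius -card_k expf_card.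
rewrite !skewM tE; move: u; rewrite /skewpoly => u.
elim/poly_mono_ind: u => [|u v Hu Hv|c i]; first by rewrite tmul0l ?tmul0r.
  by rewrite (tmulDr iota) (tmulDl iota) Hu Hv.
by rewrite !(tmulXnXn iota) rmorph1 mulr1 mul1r fd addnC.
Qed.

(* The action of [k[T]] on [S]: scalars act on the left, [T] by right
   multiplication by [g]. *)
Definition act (a : kT) (v : S) : S := lin (fun l => v * g ^+ l) a.

Lemma actDl a b v : act (a + b) v = act a v + act b v.
Proof. exact: linearD. Qed.
Lemma act0l v : act 0 v = 0. Proof. exact: linear0. Qed.
Lemma actDr a v w : act a (v + w) = act a v + act a w.
Proof.
rewrite /act /lin -big_split; apply: eq_bigr => l _ /=.
by rewrite mulrDl scalerDr.
Qed.
Lemma act0r a : act a 0 = 0.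
Proof. by rewrite /act /lin big1 // => l _; rewrite mul0r scaler0. Qed.
Lemma act_sumr a n (v : 'I_n -> S) : act a (\sum_i v i) = \sum_i act a (v i).
Proof. by apply: (big_morph _ (actDr a) (act0r a)). Qed.

Lemma actXn c i v : act (c *: 'X^i) v = c *: (v * g ^+ i : S).
Proof. exact: linXn. Qed.
Lemma actC c v : act c%:P v = c *: v.
Proof. by rewrite -alg_polyC -(expr0 'X) actXn expr0 mulr1. Qed.
Lemma actX v : act 'X v = v * g.
Proof. by rewrite -['X]scale1r -(expr1 'X) actXn scale1r expr1. Qed.

Lemma actM a b v : act (a * b) v = act a (act b v).
Proof.
elim/poly_mono_ind: a => [|a a' Ha Ha'|c i]; first by rewrite mul0r !act0l.
  by rewrite mulrDl !actDl Ha Ha'.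
elim/poly_mono_ind: b => [|b b' Hb Hb'|e j]; first by rewrite mulr0 !act0l act0r.
  by rewrite mulrDr !actDl actDr Hb Hb'.
rewrite -scalerAl -scalerAr -exprD scalerA !actXn -scalerAlS scalerA.
by rewrite -mulrA -exprD addnC.
Qed.

Lemma act_mulr a v (u : S) : GRing.comm g u -> act a v * u = act a (v * u).
Proof.
move=> cu; rewrite /act /lin mulr_suml; apply: eq_bigr => l _.
rewrite -scalerAlS -!mulrA; congr (_ *: _); congr (v * _).
exact/commr_sym/commrX/commr_sym.
Qed.

Lemma act_phi a v : act (map_poly iota a) v = v * phi a.
Proof.
elim/poly_ind: a v => [|a c IH] v; first by rewrite !rmorph0 act0l mulr0.
rewrite !rmorphD !rmorphM /= phi_X phi_C map_polyX map_polyC actDl mulrC actM.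
by rewrite actX IH -mulrA mulrDr actC skewZ iotaC_comm.
Qed.

(** Coordinates in the basis [1, tau, ..., tau^r'] of [S] over [k[T]]; with this module structure
    [S] is the Anderson motive of [phi]. *)
Definition Psi (a : 'rV[kT]_r) : S := \sum_j act (a 0 j) (tau j).

Lemma PsiD a b : Psi (a + b) = Psi a + Psi b.
Proof. by rewrite /Psi -big_split; apply: eq_bigr => j _; rewrite mxE actDl. Qed.
Lemma PsiZ c a : Psi (c *: a) = act c (Psi a).
Proof. by rewrite /Psi act_sumr; apply: eq_bigr => j _; rewrite mxE actM. Qed.
Lemma Psi0 : Psi 0 = 0.
Proof. by rewrite /Psi big1 // => j _; rewrite mxE act0l. Qed.
Lemma PsiB a b : Psi (a - b) = Psi a - Psi b.
Proof. by apply: (addIr (Psi b)); rewrite -PsiD !subrK. Qed.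
Lemma Psi_delta i : Psi (delta_mx 0 i) = tau i.
Proof.
rewrite /Psi (bigD1 i) //= mxE !eqxx -[true && true]/true.
rewrite -[1%:R]/(1%:P) actC scale1r big1 ?addr0 // => j /negPf ne.
by rewrite mxE eqxx ne act0l.
Qed.
Lemma Psi_mulmx n (c : 'rV[kT]_n) (M : 'M[kT]_(n, r)) :
  Psi (c *m M) = \sum_i act (c 0 i) (Psi (row i M)).
Proof.
rewrite mulmx_sum_row (big_morph _ PsiD Psi0).
by apply: eq_bigr => i _; rewrite PsiZ.
Qed.

Lemma Psi_const (c : nat -> k) :
  Psi (\row_j (c j)%:P) = \poly_(j < r) c j :> {poly k}.
Proof.
rewrite /Psi poly_def.
apply: (@eq_bigr {poly k} 0 +%R) => j _.
by rewrite mxE actC.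
Qed.

(** Subtracting [c tau^e g] cancels the leading term of [v], and [c tau^e] is itself of smaller
    degree; induction applies to both, and ['X] acts as right multiplication by [g]. *)
Lemma Psi_surj (v : S) : exists a, Psi a = v.
Proof.
have [m] := ubnP (size (v : {poly k})); elim: m v => // m IH v /ltnSE lev.
have [le|lt] := leqP (size (v : {poly k})) r.
  exists (\row_j ((v : {poly k})`_j)%:P).
  rewrite (Psi_const (fun j => (v : {poly k})`_j)); apply/polyP => j.
  by rewrite coef_poly; case: ltnP => // h; rewrite nth_default // (leq_trans le).
set s := size (v : {poly k}) in lev lt; set e := (s - r.+1)%N.
pose c := (v : {poly k})`_s.-1 / frob e (gc r).
have fr0 : frob e (gc r) != 0 by rewrite fmorph_eq0 g_lead.
pose w : S := c *: tau e.
have v0 : v != 0 by rewrite -size_poly_eq0; apply/eqP => h; rewrite /s h in lt.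
have c0 : c != 0.
  by rewrite mulf_neq0 ?invr_eq0 // -lead_coefE lead_coef_eq0.
have sw : size (w : {poly k}) = e.+1 by rewrite size_scale // size_polyXn.
have es : (e + r.+1 = s)%N by rewrite subnK.
have [|b hb] := IH w.
  by rewrite sw (leq_trans _ lev) // -es addnS ltnS -addSnnS leq_addr.
have wg : (w * g : {poly k}) = c *: (map_poly (frob e) (g : {poly k}) * 'X^e).
  by rewrite skewM (tmulXn iota).
have sz : (size ((v - w * g)%R : {poly k}) < s)%N.
  have [-> | nz] := eqVneq (v - w * g) 0.
    by rewrite size_poly0 (leq_trans _ lt).
  have s1 : (0 < s)%N by rewrite (leq_trans _ lt).
  rewrite -[s]prednK // ltnS; apply/leq_sizeP => j lej.
  have [jl|jl] := ltnP j s; last first.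
    rewrite coefB wg coefZ coefMXn nth_default // [X in c * X]ifF; last first.
      by apply/negbTE; rewrite -leqNgt (leq_trans _ jl) // -es leq_addr.
    rewrite [X in c * X]nth_default ?mulr0 ?subr0 // size_map_poly sg.
    by rewrite leq_subRL -?es // ?(leq_trans _ jl) // -es ?leq_addr.
  have -> : j = s.-1 by apply/eqP; rewrite eqn_leq lej -ltnS prednK // jl.
  rewrite coefB wg coefZ coefMXn ifF; last first.
    by apply/negbTE; rewrite -leqNgt -es addnS leq_addr.
  have -> : (s.-1 - e = r)%N by rewrite -es addnS /= addKn.
  by rewrite coef_map /= /c divfK // subrr.
have [a ha] := IH _ (leq_trans sz lev).
exists (a + 'X *: b); rewrite PsiD PsiZ ha hb actX subrK //.
Qed.

(** Write [a = 'X *: b + c] with [c] constant. Then [Psi a = Psi b * g + Psi c], where [Psi c] has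
    degree less than [r] and a nonzero [Psi b * g] has degree at least [r]. *)
Lemma Psi_inj : injective Psi.
Proof.
suff inj0 a : Psi a = 0 -> a = 0.
  move=> a b h; apply/eqP; rewrite -subr_eq0; apply/eqP/inj0.
  by rewrite PsiB h subrr.
move=> h; pose m := (\max_(j < r) size (a 0%R j))%N.
have : forall j, (size (a 0%R j) <= m)%N.
  by move=> j; apply: (@leq_bigmax _ (fun j => size (a 0 j))).
move: h; move: (m) => {m} m; elim: m a => [|m IH] a h lea.
  apply/rowP => j; rewrite mxE; apply/eqP; rewrite -size_poly_eq0.
  by rewrite -leqn0 lea.
pose b : 'rV[kT]_r := \row_j drop_poly 1 (a 0 j).
pose c : 'rV[kT]_r := \row_j ((a 0 j)`_0)%:P.
have aE : a = 'X *: b + c.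
  apply/rowP => j; rewrite !mxE -[LHS](poly_take_drop 1) addrC mulrC; congr (_ + _).
  by apply/polyP => i; rewrite coef_take_poly coefC; case: i.
have PsiC : (Psi c : {poly k}) = \poly_(j < r) (a 0 (inord j))`_0.
  rewrite -Psi_const; congr Psi; apply/rowP => j.
  by rewrite !mxE inord_val.
have szc : (size (Psi c : {poly k}) <= r)%N by rewrite PsiC size_poly.
have g0 : g != 0 by rewrite -size_poly_eq0 sg.
have b0 : Psi b = 0.
  apply/eqP; apply: contraT => nz; move: h; rewrite aE PsiD PsiZ actX => /eqP.
  rewrite addr_eq0 => /eqP e; have := size_skewM nz g0.
  rewrite e size_polyN sg => e2; move: szc; rewrite e2 addnS /= leqNgt.
  by rewrite -[X in (X < _)%N]add0n ltn_add2r lt0n size_poly_eq0 nz.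
have c0 : c = 0.
  apply/rowP => j; rewrite !mxE; move: h; rewrite {1}aE PsiD PsiZ b0 act0r add0r.
  move/(congr1 (fun u : S => (u : {poly k})`_j)).
  rewrite PsiC coef_poly ltn_ord inord_val coef0 => e.
  by apply/eqP; rewrite polyC_eq0; apply/eqP.
rewrite aE c0 addr0 (IH b) ?scaler0 // => j.
by rewrite mxE size_drop_poly leq_subLR lea.
Qed.

Definition coord (v : S) : 'rV[kT]_r :=
  xchoose (let: ex_intro a e := Psi_surj v in
           ex_intro (fun a => Psi a == v) a (introT eqP e)).
Lemma coordK v : Psi (coord v) = v.
Proof. exact/eqP/(xchooseP (P := fun a => Psi a == v)). Qed.

(** Right multiplication by [u] in the basis [tau^i], acting on row vectors; it is [k[T]]-linear
    when [u] commutes with [g]. *)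
Definition mulr_mx (u : S) : 'M[kT]_r := \matrix_i coord (tau i * u).

Lemma Psi_row_mulr u i : Psi (row i (mulr_mx u)) = tau i * u.
Proof. by rewrite /mulr_mx rowK coordK. Qed.

Lemma Psi_mulr a u : GRing.comm g u -> Psi a * u = Psi (a *m mulr_mx u).
Proof.
move=> cu; rewrite {1}/Psi Psi_mulmx mulr_suml; apply: eq_bigr => i _.
by rewrite act_mulr // Psi_row_mulr.
Qed.

Lemma Psi_row_inj (M N : 'M[kT]_r) :
  (forall a, Psi (a *m M) = Psi (a *m N)) -> M = N.
Proof. by move=> h; apply/row_matrixP => i; rewrite !rowE; apply/Psi_inj. Qed.

Lemma mulr_mxD u v : mulr_mx (u + v) = mulr_mx u + mulr_mx v.
Proof.
apply/row_matrixP => i; rewrite linearD /=; apply: Psi_inj.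
by rewrite PsiD !Psi_row_mulr mulrDr.
Qed.

Lemma mulr_mx_phi a : mulr_mx (phi a) = (map_poly iota a)%:M.
Proof.
apply/row_matrixP => i; apply: Psi_inj.
by rewrite Psi_row_mulr rowE mul_mx_scalar PsiZ Psi_delta act_phi.
Qed.

Lemma mulr_mxM u v : GRing.comm g v -> mulr_mx (u * v) = mulr_mx u *m mulr_mx v.
Proof.
move=> cv; apply/row_matrixP => i; rewrite row_mul; apply: Psi_inj.
by rewrite -Psi_mulr // !Psi_row_mulr mulrA.
Qed.

Lemma phi_comm a : GRing.comm g (phi a).
Proof. by rewrite /GRing.comm -{1 4}(phi_X g) -!rmorphM mulrC. Qed.

Lemma comm_phi u a : GRing.comm g u -> GRing.comm u (phi a).
Proof.
move=> cu; elim/poly_ind: a => [|a c IH]; first by rewrite rmorph0; apply: commr0.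
rewrite rmorphD rmorphM /= phi_X phi_C; apply: commrD; last exact: iotaC_comm.
by apply: commrM => //; apply: commr_sym.
Qed.

Lemma mulr_mx_horner (u : S) (cu : GRing.comm g u) (Q : {poly A}) :
  mulr_mx (horner_morph (fun a => comm_phi a cu : GRing.comm u (phi a)) Q)
  = horner_mx (mulr_mx u) (map_poly (map_poly iota) Q).
Proof.
elim/poly_ind: Q => [|Q a IH].
  by rewrite !rmorph0; have := mulr_mx_phi 0; rewrite !rmorph0.
rewrite !rmorphD !rmorphM /= horner_morphX horner_morphC map_polyX map_polyC /=.
by rewrite mulr_mxD mulr_mxM // IH mulr_mx_phi horner_mx_X horner_mx_C.
Qed.

Lemma mulr_mx_inj : injective mulr_mx.
Proof.
move=> u v /row_matrixP /(_ ord0) /(congr1 Psi).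
rewrite !Psi_row_mulr; apply: skew_mulrI.
by rewrite -size_poly_eq0 size_polyXn.
Qed.

(** A vector in the kernel would yield a zero divisor in [S]. *)
Lemma det_mulr_mx u : GRing.comm g u -> u != 0 -> \det (mulr_mx u) != 0.
Proof.
move=> cu u0; apply/negP => /det0P [a a0 h]; case/negP: a0; apply/eqP.
apply: Psi_inj; rewrite Psi0; apply: (skew_mulIr u0).
by rewrite mul0r Psi_mulr // h Psi0.
Qed.

Lemma tau_act a v : tau 1 * act a v = act (sigma a) (tau 1 * v).
Proof.
elim/poly_mono_ind: a => [|a b Ha Hb|c i].
- by rewrite rmorph0 !act0l mulr0.
- by rewrite rmorphD !actDl mulrDr Ha Hb.
by rewrite /sigma map_polyZ map_polyXn !actXn tauZ mulrA.
Qed.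

(** Left multiplication by [tau], which is only semilinear with respect to [sigma]. *)
Definition tau_mx : 'M[kT]_r := \matrix_i coord (tau i.+1).

Lemma Psi_row_tau i : Psi (row i tau_mx) = tau i.+1.
Proof. by rewrite /tau_mx rowK coordK. Qed.

Lemma Psi_tau a : tau 1 * Psi a = Psi (map_mx sigma a *m tau_mx).
Proof.
rewrite {1}/Psi Psi_mulmx mulr_sumr; apply: eq_bigr => i _.
by rewrite tau_act mxE Psi_row_tau -tauD.
Qed.

(** A companion matrix: its last row solves the expansion of [g] for [tau^r], where [g] is ['X]
    acting on [1]. *)
Lemma tau_mx_explicit (i j : 'I_r) : tau_mx i j =
  if i == ord_max then
    (gc r)^-1 *: (('X *+ (j == 0)) - (gc j)%:P) else (i.+1 == j)%:R.
Proof.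
pose M : 'M[kT]_r := \matrix_(i, j) (if i == ord_max then
    (gc r)^-1 *: (('X *+ (j == 0)) - (gc j)%:P) else (i.+1 == j)%:R).
suff -> : tau_mx = M by rewrite mxE.
apply/row_matrixP => {}i; apply: Psi_inj; rewrite Psi_row_tau.
have [->|ne] := eqVneq i ord_max.
  have -> : row ord_max M = (gc r)^-1%:P *: ('X *: delta_mx 0 0
     - \row_j (gc j)%:P).
    by apply/rowP => l; rewrite !mxE !eqxx mul_polyC mulr_natr.
  rewrite PsiZ PsiB PsiZ actX Psi_delta (Psi_const (fun j => gc j)) mul1r actC.
  have -> : (g - (\poly_(l < r) gc l : S)) = gc r *: tau r.
    rewrite -[X in X - _](coefK (g : {poly k})) sg !poly_def big_ord_recr /=.
    by rewrite addrAC subrr add0r.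
  by rewrite scalerA mulVf ?g_lead // scale1r.
have lt : (i.+1 < r)%N.
  rewrite ltn_neqAle ltn_ord andbT; apply: contraNneq ne => h.
  by apply/eqP/val_inj => /=; case: h.
have -> : row i M = delta_mx 0 (Ordinal lt).
  apply/rowP => l; rewrite !mxE (negPf ne) eqxx /= eq_sym; congr (_%:R).
by rewrite Psi_delta.
Qed.

Lemma det_tau_mx : \det tau_mx = (-1) ^+ r' * ((gc r)^-1 *: ('X - (gc 0)%:P)).
Proof.
rewrite (expand_det_col _ 0) (bigD1 ord_max) //= big1 ?addr0; last first.
  by move=> i ne; rewrite tau_mx_explicit (negPf ne) mul0r.
rewrite tau_mx_explicit !eqxx mulr1n mulrC /cofactor.
have -> : row' ord_max (col' 0 tau_mx) = 1%:M.
  apply/matrixP => i j; rewrite [LHS]mxE [LHS]mxE [RHS]mxE tau_mx_explicit ifN; last first.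
    by rewrite eq_sym neq_lift.
  by rewrite lift_max lift0.
by rewrite det1 mulr1 /= addn0.
Qed.

Lemma size_det_tau_mx : size (\det tau_mx) = 2.
Proof.
by rewrite det_tau_mx size_Msign size_scale ?size_XsubC ?invr_eq0 ?g_lead.
Qed.

(** [D] is the product of [i] Frobenius twists of [tau_mx], each with a determinant of degree 1. *)
Lemma Psi_tau_iter i : exists2 D : 'M[kT]_r,
  forall a, tau i * Psi a = Psi (map_mx (iter i sigma) a *m D) &
  size (\det D) = i.+1.
Proof.
elim: i => [|i [D h1 h2]].
  exists 1%:M; last by rewrite det1 size_poly1.
  by move=> a; rewrite mulmx1 map_mx_id // mul1r.
exists (map_mx sigma D *m tau_mx) => [a|].
  rewrite -add1n tauD -mulrA h1 Psi_tau map_mxM mulmxA -map_mx_comp.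
  by [].
rewrite det_mulmx det_map_mx size_mul.
- by rewrite size_map_poly h2 size_det_tau_mx addn2.
- by rewrite -size_poly_eq0 size_map_poly h2.
by rewrite -size_poly_eq0 size_det_tau_mx.
Qed.

Lemma iter_sigma i a : iter i sigma a = map_poly (frob i) a.
Proof.
elim: i => [|i IH]; first by rewrite map_frob0.
by rewrite iterS IH /sigma -map_poly_comp; apply: eq_map_poly => x; rewrite /= frobD.
Qed.

(** For the central element [tau^d], left and right multiplication agree, and [sigma^d] is the
    identity; so the semilinear matrix of [tau^d] is its matrix of right multiplication. *)
Lemma size_det_mulr_tau : size (\det (mulr_mx (tau d))) = d.+1.
Proof.
have [D h1 h2] := Psi_tau_iter d; suff -> : mulr_mx (tau d) = D by [].
apply: Psi_row_inj => a; rewrite -Psi_mulr ?tau_d_central; last first.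
  exact/commr_sym/tau_d_central.
rewrite -tau_d_central h1; congr (Psi (_ *m _)).
apply/rowP => j; rewrite mxE iter_sigma; apply/polyP => l; rewrite coef_map /=.
by rewrite /frobenius -card_k expf_card.
Qed.

(** Left multiplication by [tau] commutes with right multiplication by [u], so [tau_mx] intertwines
    the matrix of [u] with its twist. As [tau_mx] has nonzero determinant, the characteristic
    polynomials agree. *)
Lemma sigma_char_poly u : GRing.comm g u ->
  map_poly sigma (char_poly (mulr_mx u)) = char_poly (mulr_mx u).
Proof.
move=> cu; set N := mulr_mx u.
have e : tau_mx *m N = map_mx sigma N *m tau_mx.
  apply/row_matrixP => i; rewrite !rowE; apply: Psi_inj.
  have dE : delta_mx 0 i = map_mx sigma (delta_mx 0 i) :> 'rV[kT]_r.
    by apply/rowP => j; rewrite !mxE rmorph_nat.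
  rewrite !mulmxA -Psi_mulr // dE -Psi_tau -mulrA Psi_mulr //.
  by rewrite Psi_tau map_mxM.
have : map_mx polyC tau_mx *m char_poly_mx N
       = char_poly_mx (map_mx sigma N) *m map_mx polyC tau_mx.
  rewrite /char_poly_mx mulmxBr mulmxBl -!map_mxM e; congr (_ - _).
  by rewrite scalar_mxC.
move/(congr1 determinant); rewrite !det_mulmx [LHS]mulrC => /mulIf e2.
rewrite map_char_poly; apply/esym/e2.
rewrite det_map_mx polyC_eq0 -size_poly_eq0 size_det_tau_mx //.
Qed.
End Motive.

(** * Descent to [A] and the minimal polynomial of [pi] *)

Section FrobeniusFixed.
Variables (K : finFieldType) (k : fieldType) (iota : {rmorphism K -> k}).

(** The polynomial [X^q - X] already has the [q] elements of [K] as roots. *)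
Lemma fixed_frobenius (x : k) : frobenius iota 1 x = x -> exists c, x = iota c.
Proof.
move=> fx; suff /mapP [c _ ->] : x \in map iota (enum K) by exists c.
apply: contraT => nx.
pose f : {poly k} := 'X^#|K| - 'X.
have sf : size f = #|K|.+1.
  by rewrite size_polyDl size_polyXn // size_polyN size_polyX ltnS card_gt1.
have rf (y : k) : frobenius iota 1 y = y -> root f y.
  by rewrite /frobenius expn1 rootE !hornerE => ->; rewrite subrr.
have : (size (x :: map iota (enum K)) < size f)%N.
  apply: max_poly_roots; first by rewrite -size_poly_eq0 sf.
    rewrite /= rf //=; apply/allP => _ /mapP [c _ ->]; apply: rf.
    exact: frob_iota.
  by rewrite /= nx map_inj_uniq ?enum_uniq //; apply: fmorph_inj.
by rewrite sf /= size_map -cardE ltnn.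
Qed.

Lemma map_poly_descent (B C : nzRingType) (f : {rmorphism B -> C}) (a : {poly C}) :
  (forall i, exists c, a`_i = f c) -> exists b, a = map_poly f b.
Proof.
elim/poly_ind: a => [|a c IH] h; first by exists 0; rewrite rmorph0.
have [|b hb] := IH.
  by move=> i; have := h i.+1; rewrite coefD coefMX coefC addr0.
have [d hd] := h 0; exists (b * 'X + d%:P).
rewrite rmorphD rmorphM /= map_polyX map_polyC /= -hb -hd.
by rewrite coefD coefMX coefC add0r.
Qed.
End FrobeniusFixed.

Section MinPoly.
Variables (K k : finFieldType) (iota : {rmorphism K -> k}).
Local Notation q := #|K|.
Local Notation S := (skewpoly iota).
Local Notation A := {poly K}.
Variables (r' d : nat) (g : skewpoly iota).
Local Notation r := r'.+1.
Hypothesis card_k : #|k| = (q ^ d)%N.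
Hypothesis sg : size (g : {poly k}) = r.+1.
Local Notation phi := (phi g).
Local Notation mulr_mx := (mulr_mx sg).
Local Notation pi := (tau iota d).
Local Notation mapA := (map_poly (map_poly iota)).

Definition ev (u : S) (cu : GRing.comm g u) : {poly A} -> S :=
  horner_morph (fun a => comm_phi a cu : GRing.comm u (phi a)).
HB.instance Definition _ u cu := GRing.RMorphism.on (@ev u cu).

Lemma ev_comm u (cu : GRing.comm g u) Q : GRing.comm g (ev cu Q).
Proof.
elim/poly_ind: Q => [|Q a IH]; first by rewrite rmorph0; apply: commr0.
rewrite rmorphD rmorphM /= /ev horner_morphX horner_morphC /=.
by apply: commrD; [apply: commrM|apply: phi_comm].
Qed.

Lemma evE u (cu : GRing.comm g u) Q :
  ev cu Q = \sum_(i < size Q) phi Q`_i * u ^+ i.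
Proof.
rewrite /ev /horner_morph horner_coef size_map_inj_poly ?rmorph0 //.
  by apply: eq_bigr => i _; rewrite coef_map.
by apply: (phi_inj sg).
Qed.

Lemma char_poly_descent u : GRing.comm g u ->
  exists X : {poly A}, char_poly (mulr_mx u) = mapA X.
Proof.
move=> cu; apply: map_poly_descent => i.
apply: map_poly_descent => j; apply: fixed_frobenius.
have := congr1 (fun Q : {poly {poly k}} => Q`_i`_j) (sigma_char_poly sg cu).
by rewrite coef_map /= coef_map.
Qed.

Lemma comm_pi : GRing.comm g pi.
Proof. exact/commr_sym/tau_d_central. Qed.

Hypothesis d_gt0 : (0 < d)%N.
(** Evaluation at the constant coefficient of [g] is the structure map [A -> k]; in the application
    its kernel is generated by [p], of degree [d]. *)
Hypothesis char_large : forall a : A, a != 0 ->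
  (map_poly iota a).[(g : {poly k})`_0] = 0 -> (d < size a)%N.

(** As [d > 0], the constant coefficient of [tau^d] vanishes, so that of [phi_(Q_0)] vanishes too:
    [Q_0] lies in the kernel of [A -> k]. *)
Lemma ev_pi_eq0 Q : ev comm_pi Q = 0 -> Q`_0 != 0 -> (d < size (Q`_0)%R)%N.
Proof.
move=> h Q0; apply: char_large => //; rewrite -coef0_phi.
move: h; elim/poly_ind: Q {Q0} => [|Q a _]; first by rewrite rmorph0 coef0 rmorph0 coef0.
rewrite rmorphD rmorphM /= {2 3}/ev horner_morphX horner_morphC /= => h.
rewrite coefD coefMX coefC add0r.
have := congr1 (fun f : {poly k} => f`_0) h; rewrite coefD coef0_skewM.
by rewrite coefXn eq_sym (gtn_eqF d_gt0) mulr0 add0r coef0.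
Qed.

Variable P : {poly A}.
Hypothesis (monP : P \is monic) (evP : ev comm_pi P = 0).
Hypothesis minP : forall Q, Q != 0 -> ev comm_pi Q = 0 -> (size P <= size Q)%N.

(* Write [char_poly = Q * P]. As [p] divides [P`_0] and the determinant has degree
   [d], [Q`_0] lies in [K], so [ev Q] is nonzero and acts injectively; but [Q]
   divides the characteristic polynomial, so [Q] can only be [1]. *)
Lemma minpoly_char : char_poly (mulr_mx pi) = mapA P.
Proof.
have [X hX] := char_poly_descent comm_pi.
have iA : injective (map_poly iota) by apply: map_poly_inj.
have iAA : injective mapA by apply: map_inj_poly; rewrite ?rmorph0.
have mX : X \is monic.
  have := char_poly_monic (mulr_mx pi); rewrite hX !monicE.
  by rewrite lead_coef_map_inj ?rmorph0 // -(rmorph1 (map_poly iota)) => /eqP/iA ->.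
have evX : ev comm_pi X = 0.
  apply: (@mulr_mx_inj _ _ _ _ _ sg).
  rewrite mulr_mx_horner -hX Cayley_Hamilton.
  by rewrite -(rmorph0 phi) mulr_mx_phi !rmorph0.
have [Q hQ] : exists Q, X = Q * P.
  exists (X %/ P); apply/eqP; rewrite -subr_eq0.
  have /(canLR (addKr _)) hm := Pdiv.IdomainMonic.divp_eq monP X.
  rewrite addrC hm; apply: contraT => nz; have := ltn_modpN0 X (monic_neq0 monP).
  rewrite ltnNge minP // -hm rmorphD rmorphN rmorphM /= evX evP mulr0.
  by rewrite oppr0 addr0.
have mQ : Q \is monic by rewrite -(monicMr _ monP) -hQ.
have sX0 : size X`_0 = d.+1.
  rewrite -(size_det_mulr_tau card_k sg) -(size_map_poly iota).
  have -> : map_poly iota X`_0 = (char_poly (mulr_mx pi))`_0 by rewrite hX coef_map.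
  by rewrite char_poly_det size_Msign.
have /andP [Q0 P0] : (Q`_0 != 0) && (P`_0 != 0).
  by rewrite -negb_or -mulf_eq0 -coef0M -hQ -size_poly_eq0 sX0.
have sP0 := ev_pi_eq0 evP P0.
have sQ0 : size (Q`_0) = 1%N.
  have : (0 < size (Q`_0)%R)%N by rewrite lt0n size_poly_eq0.
  move: sX0 sP0; rewrite hQ coef0M size_mul //.
  case: (size Q`_0) => // a; rewrite addSn /= => h; rewrite -h => + _.
  by rewrite -[X in (_ <= X)%N]add0n leq_add2r leqn0 => /eqP ->.
have evQ : ev comm_pi Q != 0.
  by apply: contraTneq d_gt0 => h; have := ev_pi_eq0 h Q0; rewrite sQ0; case: (d).
have sQ : size Q = 1%N.
  have : (0 < size Q)%N by rewrite lt0n size_poly_eq0 monic_neq0.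
  rewrite leq_eqVlt eq_sym => /orP [/eqP //|sQ].
  have := det_mulr_mx sg (ev_comm comm_pi Q) evQ.
  rewrite mulr_mx_horner => /negP [].
  apply/eqP/(@det_horner_mx_eq0 _ _ _ _ (mapA P)).
  - exact: monic_map.
  - by rewrite size_map_inj_poly ?rmorph0.
  by rewrite hX hQ rmorphM.
suff -> : P = X by [].
have /eqP/size_poly1P [c _ Qc] := sQ; move: mQ; rewrite Qc monicE lead_coefC.
by move/eqP => c1; rewrite hQ Qc c1 mul1r.
Qed.

Lemma size_minpoly : size P = r.+1.
Proof.
have := size_char_poly (mulr_mx pi); rewrite minpoly_char size_map_inj_poly ?rmorph0 //.
by apply: map_inj_poly => //; rewrite ?rmorph0 //; apply: fmorph_inj.
Qed.

(** The trace of [pi] is the opposite of the coefficient of [P], that of [phi a] is [r a], and that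
    of [phi n * u] is a multiple of [n] over [k]; divisibility descends from [k[T]] to [A]. *)
Lemma minpoly_trace (n a : A) (u : S) : GRing.comm g u ->
  pi = phi a + phi n * u -> n %| P`_r' + r%:R * a.
Proof.
move=> cu e; rewrite -(dvdp_map iota) rmorphD rmorphM rmorph_nat /=.
have := char_poly_trace (mulr_mx pi) (isT : (0 < r)%N).
rewrite minpoly_char /= coef_map /= => ->.
rewrite e mulr_mxD mulr_mxM // !mulr_mx_phi mxtraceD mxtrace_scalar mul_scalar_mx mxtraceZ.
by rewrite mulr_natl opprD addrAC addNr add0r dvdpNr dvdp_mulr.
Qed.
End MinPoly.

(** * The refined index *)

Lemma small_dvdp_eq0 (F : fieldType) (n a : {poly F}) :
  (size a < size n)%N -> n %| a -> a = 0.
Proof.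
move=> lt dv; apply: contraTeq lt => a0; rewrite -leqNgt.
exact: dvdp_leq.
Qed.

(* [(A/n)^l] is finite. *)
Lemma mulmx_mod_onto (K : finFieldType) l (n : {poly K}) (C : 'M[{poly K}]_l) :
  n != 0 ->
  (forall x : 'rV_l, (forall j, n %| (x *m C) 0 j) -> forall i, n %| x 0 i) ->
  forall y : 'rV_l, exists x : 'rV_l, forall j, n %| (x *m C) 0 j - y 0 j.
Proof.
move=> n0 inj y; set s := (size n).-1.
have sn : size n = s.+1 by rewrite /s prednK // lt0n size_poly_eq0.
(* Residues modulo [n] are encoded by their [s] coefficients, so that [C] induces a self-map of a
   finite type. *)
pose up (v : {ffun 'I_l -> 'rV[K]_s}) : 'rV[{poly K}]_l := \row_i rVpoly (v i).
pose down (x : 'rV[{poly K}]_l) := [ffun i => poly_rV (x 0 i %% n) : 'rV[K]_s].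
have downK x i : rVpoly (down x i) = x 0 i %% n.
  by rewrite ffunE poly_rV_K // -ltnS -sn ltn_modp.
have down_eq x x' : down x = down x' -> forall i, n %| x 0 i - x' 0 i.
  by move=> h i; apply/modp_eq0P; rewrite modpD modpN -!downK h subrr.
pose F v := down (up v *m C).
have Finj : injective F.
  move=> v w /down_eq h; apply/ffunP => i; apply: (can_inj rVpolyK).
  apply/eqP; rewrite -subr_eq0; apply/eqP/(@small_dvdp_eq0 _ n).
    rewrite sn ltnS (leq_trans (size_polyD _ _)) // size_polyN geq_max.
    by rewrite !size_poly.
  have := inj (up v - up w) _ i; rewrite !mxE; apply => j.
  by have := h j; rewrite mulmxBl !mxE.
have [G FK GK] := injF_bij Finj.
exists (up (G (down y))) => j.
have e : down (up (G (down y)) *m C) = down y := GK _.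
exact: (down_eq _ _ e).
Qed.

Section RefinedIndex.
Variables (K k : finFieldType) (iota : {rmorphism K -> k}).
Local Notation q := #|K|.
Local Notation S := (skewpoly iota).
Local Notation A := {poly K}.
Variables (r' d : nat) (g : skewpoly iota).
Local Notation r := r'.+1.
Hypothesis card_k : #|k| = (q ^ d)%N.
Hypothesis sg : size (g : {poly k}) = r.+1.
Local Notation phi := (phi g).
Local Notation pi := (tau iota d).
Local Notation cpi := (comm_pi g card_k).
Hypothesis d_gt0 : (0 < d)%N.
Hypothesis char_large : forall a : A, a != 0 ->
  (map_poly iota a).[(g : {poly k})`_0] = 0 -> (d < size a)%N.
Variable P : {poly A}.
Hypothesis (monP : P \is monic) (evP : ev cpi P = 0).
Hypothesis minP : forall Q, Q != 0 -> ev cpi Q = 0 -> (size P <= size Q)%N.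

Variable b : nat -> A.
Hypothesis monb : forall i, (i < r')%N -> b i \is monic.
Hypothesis dvdb : forall i, (i.+1 < r')%N -> b i %| b i.+1.
Variable f : S -> nat -> A.
Hypothesis fD : forall u v i, GRing.comm g u -> GRing.comm g v ->
  (i < r')%N -> b i %| f (u + v) i - (f u i + f v i).
Hypothesis fZ : forall a u i, GRing.comm g u -> (i < r')%N ->
  b i %| f (phi a * u) i - a * f u i.
Hypothesis f_onto : forall c : nat -> A, exists2 u, GRing.comm g u &
  forall i, (i < r')%N -> b i %| f u i - c i.
Hypothesis f_ker : forall u, GRing.comm g u ->
  ((forall i, (i < r')%N -> b i %| f u i) <-> exists Q, u = ev cpi Q).

Local Notation ev := (ev cpi).

Lemma ev_C a : ev a%:P = phi a. Proof. exact: horner_morphC. Qed.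
Lemma ev_CM a Q : ev (a%:P * Q) = phi a * ev Q.
Proof. by rewrite rmorphM /= ev_C. Qed.
Lemma evD Q R : ev (Q + R) = ev Q + ev R. Proof. exact: rmorphD. Qed.
Lemma evB Q R : ev (Q - R) = ev Q - ev R.
Proof. by apply: (addIr (ev R)); rewrite -evD !subrK. Qed.
Lemma ev_X : ev 'X = pi. Proof. exact: horner_morphX. Qed.

(** Division by the monic [P], of degree [r]. Together with [ev_eq0] it makes [1, pi, ..., pi^r'] a
    basis of [A[pi]]. *)
Lemma ev_small u Q : u = ev Q -> exists2 Q', u = ev Q' & (size Q' <= r)%N.
Proof.
move=> ->; exists (Q %% P).
  rewrite {1}(Pdiv.IdomainMonic.divp_eq monP Q) rmorphD rmorphM /= evP.
  by rewrite mulr0 add0r.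
rewrite -ltnS -(size_minpoly sg d_gt0 char_large monP evP minP).
by rewrite ltn_modpN0 ?monic_neq0.
Qed.

Lemma ev_eq0 (Q : {poly A}) : (size Q <= r)%N -> ev Q = 0 -> Q = 0.
Proof.
move=> sQ eQ; apply: contraTeq sQ => Q0; rewrite -ltnNge.
by rewrite -(size_minpoly sg d_gt0 char_large monP evP minP) minP.
Qed.

Lemma comm_sum l (x : 'I_l -> A) (w : 'I_l -> S) :
  (forall i, GRing.comm g (w i)) -> GRing.comm g (\sum_i phi (x i) * w i).
Proof.
move=> cw; apply: (big_ind (fun u => GRing.comm g u)) => [|u v|i _].
- exact: commr0.
- exact: commrD.
by apply: commrM => //; apply: phi_comm.
Qed.

Lemma f_sum l (x : 'I_l -> A) (w : 'I_l -> S) j :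
  (forall i, GRing.comm g (w i)) -> (j < r')%N ->
  b j %| f (\sum_i phi (x i) * w i) j - \sum_i x i * f (w i) j.
Proof.
move=> cw lj; elim: l x w cw => [|l IH] x w cw.
  (* The value [f 0] is controlled only modulo [b j], because [0] lies in [A[pi]]. *)
  rewrite !big_ord0 subr0; have /f_ker [_] := commr0 g; apply=> //.
  by exists 0; rewrite rmorph0.
rewrite !big_ord_recr /=.
have cl : GRing.comm g (w ord_max) by [].
have cs := comm_sum (fun i => x (widen_ord (leqnSn l) i))
  (fun i => cw (widen_ord (leqnSn l) i)).
have cm : GRing.comm g (phi (x ord_max) * w ord_max).
  by apply: commrM => //; apply: phi_comm.
have h1 := fD cs cm lj; have h2 := fZ (x ord_max) cl lj.
have h3 := IH _ _ (fun i => cw (widen_ord (leqnSn l) i)).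
have := dvdp_add (dvdp_add h1 h2) (h3 (fun i => x (widen_ord (leqnSn l) i))).
by congr (_ %| _); ring.
Qed.

Lemma ev_comm_pi Q : GRing.comm g (ev Q).
Proof. exact: ev_comm. Qed.

Variable n : A.
Hypothesis n0 : n != 0.

Lemma phi_n0 : phi n != 0.
Proof. by rewrite -size_poly_eq0 (size_phi sg). Qed.

(** One may replace [y] by its remainder modulo [n]; if nonzero, its image has smaller degree in
    [tau] than [phi n] and cannot be a multiple of it. *)
Lemma phi_dvd y u : phi y = phi n * u -> n %| y.
Proof.
move=> e; apply/modp_eq0P/eqP; apply: contraT => ym.
have e2 : phi (y %% n) = phi n * (u - phi (y %/ n)).
  by rewrite mulrBr -e -rmorphM -rmorphB mulrC {2}(divp_eq y n) addrAC subrr add0r.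
have m0 : phi (y %% n) != 0 by rewrite -size_poly_eq0 (size_phi sg).
have nz : u - phi (y %/ n) != 0 by apply: contraNneq m0 => h; rewrite e2 h mulr0.
have := size_skewM phi_n0 nz; rewrite -e2 !(size_phi sg) // => h.
have : (r * (size n).-1 <= r * (size (y %% n)%R).-1)%N.
  rewrite -ltnS h addSn /=.
  have : (0 < size ((u - phi (y %/ n))%R : {poly k}))%N by rewrite lt0n size_poly_eq0.
  by case: size => // m _; rewrite addnS ltnS leq_addr.
rewrite leq_pmul2l // leqNgt => /negP [].
have := ltn_modp y n; rewrite n0.
have : (0 < size (y %% n)%R)%N by rewrite lt0n size_poly_eq0.
by case: (size (y %% n)) => // m _; case: (size n).
Qed.

(** Since [phi n * w i = (pi - 1)^(i+1)] lies in [A[pi]], each [b j] divides [n * f (w i) j], and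
    [C] collects the quotients. Independence of the [w i] modulo [n] makes [C] injective, hence
    surjective, modulo [n]. *)
Lemma refined_index_dvd u : (0 < r')%N -> GRing.comm g u ->
  pi = 1 + phi n * u -> n %| b 0.
Proof.
move=> r0 cu e.
pose w (i : 'I_r') : S := phi n ^+ i * u ^+ i.+1.
have cw i : GRing.comm g (w i).
  by apply: commrM; apply: commrX => //; apply: phi_comm.
have nw i : phi n * w i = ev (('X - 1) ^+ i.+1).
  rewrite rmorphXn rmorphB /= ev_X rmorph1 e addrAC subrr add0r.
  rewrite exprMn_comm; last exact/commr_sym/comm_phi.
  by rewrite mulrA -exprS.
have bf i j : (j < r')%N -> b j %| n * f (w i) j.
  move=> lj; have h := fZ n (cw i) lj.
  have [_ /(_ _ j lj) h2] := f_ker (commrM (phi_comm g n) (cw i)).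
  have := dvdp_sub (h2 (ex_intro _ _ (nw i))) h.
  by rewrite opprB addrCA subrr addr0.
pose C : 'M[A]_r' := \matrix_(i, j) ((n * f (w i) j) %/ b j).
have CE (x : 'rV_r') (j : 'I_r') : b j * (x *m C) 0 j = n * \sum_i x 0 i * f (w i) j.
  rewrite mxE !mulr_sumr; apply: eq_bigr => i _; rewrite mxE mulrCA.
  by rewrite [b j * _]mulrC divpK ?bf // mulrCA.
have inj (x : 'rV_r') : (forall j, n %| (x *m C) 0 j) -> forall i, n %| x 0 i.
  move=> h; pose W := \sum_i phi (x 0 i) * w i.
  have cW : GRing.comm g W by apply: comm_sum.
  have [fW _] := f_ker cW; have [j lj|Q eQ] := fW.
    have := f_sum (fun i => x 0 i) cw lj; rewrite dvdp_subl //.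
    rewrite -(@dvdp_mul2l _ n) // -(CE x (Ordinal lj)) mulrC.
    by apply: dvdp_mul.
  have [Q' eQ' sQ'] := ev_small eQ.
  (* Both sides have degree less than [r], so it is enough that they agree at [pi]. *)
  have z : n%:P * Q' = \sum_i (x 0 i)%:P * ('X - 1) ^+ i.+1.
    apply/eqP; rewrite -subr_eq0; apply/eqP/ev_eq0.
      rewrite (leq_trans (size_polyD _ _)) // geq_max size_polyN mul_polyC.
      rewrite (leq_trans (size_scale_leq _ _)) //=.
      apply: (big_ind (fun p : {poly A} => size p <= r)%N) => [|a c ha hc|i _].
      - by rewrite size_poly0.
      - by rewrite (leq_trans (size_polyD _ _)) // geq_max ha.
      rewrite mul_polyC (leq_trans (size_scale_leq _ _)) //.
      by rewrite size_exp_XsubC ltnS.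
    have e1 : ev (n%:P * Q') = phi n * W by rewrite ev_CM -eQ'.
    have e2 : ev (\sum_i (x 0 i)%:P * ('X - 1) ^+ i.+1) = phi n * W.
      rewrite rmorph_sum mulr_sumr; apply: eq_bigr => i _.
      transitivity (phi (x 0 i) * ev (('X - 1) ^+ i.+1)); first exact: ev_CM.
      rewrite -nw !mulrA -!(rmorphM phi).
      by rewrite [n * _]mulrC.
    by rewrite evB e1 e2 subrr.
  (* Replacing ['X] by ['X + 1] turns the powers of ['X - 1] into monomials, and each [x 0 i] is
     read off as a coefficient of a multiple of [n]. *)
  move=> i; have := congr1 (fun p => (p \Po ('X + 1))`_i.+1) z.
  rewrite comp_polyM comp_polyC coefCM.
  rewrite linear_sum /= coef_sum (bigD1 i) //= big1 ?addr0; last first.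
    move=> j ne; rewrite comp_polyM comp_polyC coefCM rmorphXn /= comp_polyB.
    rewrite comp_polyX -[1]/(1%:P) comp_polyC addrK coefXn eqSS.
    by rewrite eq_sym [_ == _](negPf ne) mulr0.
  rewrite comp_polyM comp_polyC coefCM rmorphXn /= comp_polyB.
  rewrite comp_polyX -[1]/(1%:P) comp_polyC addrK coefXn eqxx mulr1 => <-.
  exact: dvdp_mulr.
have [x hx] := mulmx_mod_onto n0 inj (delta_mx 0 (Ordinal r0)).
have := hx (Ordinal r0); rewrite [X in _ - X]mxE !eqxx /= => h.
have := CE x (Ordinal r0) => /= h2.
(* The entry of [x *m C] at [0] was chosen congruent to 1 modulo [n], so both terms are multiples of
   [n]. *)
have -> : b 0 = n * \sum_i x 0 i * f (w i) 0%N
  - b 0 * ((x *m C) 0 (Ordinal r0) - 1).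
  by rewrite -h2 mulrBr mulr1 subKr.
by apply: dvdp_sub; [apply: dvdp_mulr | apply: dvdp_mull].
Qed.

Lemma dvd_refined i : n %| b 0 -> (i < r')%N -> n %| b i.
Proof.
move=> nb; elim: i => [//|i IH] li.
exact: dvdp_trans (IH (ltnW li)) (dvdb li).
Qed.

(** Surjectivity of [C] modulo [n] gives a combination of the [b_i e_i] equal to [pi + z] modulo
    [n]. The trace relation then determines [z] modulo [n], as [r] is invertible in [K]. *)
Lemma refined_index_root : (0 < r')%N -> r%:R != 0 :> K ->
  n %| P`_r' + r%:R -> n %| b 0 ->
  exists2 u, GRing.comm g u & pi = 1 + phi n * u.
Proof.
move=> r0 rK nP nb0.
have /fin_all_exists2 [e ce fe] (i : 'I_r') : exists2 u, GRing.comm g u &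
    forall j : 'I_r', b j %| f u j - (i == j)%:R.
  have [u cu hu] := f_onto (fun j => (i == j :> nat)%:R); exists u => // j.
  exact: hu.
pose b' (i : 'I_r') := b i %/ n.
have bE (i : 'I_r') : b i = b' i * n by rewrite /b' divpK // dvd_refined.
have b'0 i : b' i != 0.
  by have := monic_neq0 (monb (ltn_ord i)); rewrite bE mulf_eq0 negb_or => /andP [].
have /fin_all_exists2 [Q eQ sQ] (i : 'I_r') : exists2 Q, phi (b i) * e i = ev Q &
    (size Q <= r)%N.
  have cbe : GRing.comm g (phi (b i) * e i).
    by apply: commrM (ce i); apply: phi_comm.
  have [/(_ _)[]] := f_ker cbe; last by move=> R /ev_small.
  (* All coordinates of [b_i e_i] vanish: the one at [i] because of the factor [b i], the others
     because [f (e i) j] is already divisible by [b j]. *)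
  move=> j lj; have h1 := fZ (b i) (ce i) lj; rewrite -(dvdp_subl _ h1).
  rewrite opprB addrCA subrr addr0.
  have [->|ne] := eqVneq (i : nat) j; first exact: dvdp_mulr.
  by apply: dvdp_mull; have := fe i (Ordinal lj); rewrite -val_eqE (negPf ne) subr0.
(* Leaving out the constant terms of the [Q i] makes [C] square; they reappear as the unspecified
   [z] in [decomp]. *)
pose C : 'M[A]_r' := \matrix_(i, j) (Q i)`_j.+1.
pose V (x : 'rV[A]_r') := \sum_i phi (x 0 i * b' i) * e i.
have cV x : GRing.comm g (V x) by apply: comm_sum ce.
have VE x : phi n * V x = ev (\sum_i (x 0 i)%:P * Q i).
  rewrite rmorph_sum mulr_sumr; apply: eq_bigr => i _.
  transitivity (phi (x 0 i) * ev (Q i)); last exact/esym/ev_CM.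
  rewrite -eQ !mulrA -!(rmorphM phi) bE; congr (phi _ * _); ring.
have decomp (x y : 'rV[A]_r') : (forall j, n %| (x *m C) 0 j - y 0 j) ->
    exists (z : A) R, \sum_i (x 0 i)%:P * Q i
      = z%:P + \sum_(j < r') (y 0 j) *: 'X^(j.+1) + n%:P * R.
  move=> h; pose T := \sum_i (x 0 i)%:P * Q i.
  have sT : (size T <= r)%N.
    apply: (big_ind (fun p : {poly A} => size p <= r)%N) => [|a c ha hc|i _].
    - by rewrite size_poly0.
    - by rewrite (leq_trans (size_polyD _ _)) // geq_max ha.
    by rewrite mul_polyC (leq_trans (size_scale_leq _ _)).
  have TE j : T`_j.+1 = \sum_i x 0 i * (Q i)`_j.+1.
    by rewrite coef_sum; apply: eq_bigr => i _; rewrite coefCM.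
  exists T`_0, (\sum_(j < r') (((x *m C) 0 j - y 0 j) %/ n) *: 'X^(j.+1)).
  rewrite -/T -addrA mulr_sumr -big_split /=.
  rewrite -{1}(coefK T) poly_def (big_ord_widen _ (fun j => T`_j *: 'X^j) sT).
  rewrite big_mkcond big_ord_recl /= expr0 alg_polyC; congr (_ + _).
    by case: ltnP => // h0; rewrite nth_default ?polyC0.
  apply: eq_bigr => j _; rewrite mul_polyC scalerA mulrC divpK // -scalerDl.
  rewrite addrC subrK /bump add1n; case: ltnP => h0.
    by rewrite TE mxE; congr (_ *: _); apply: eq_bigr => i _; rewrite mxE.
  suff -> : (x *m C) 0 j = 0 by rewrite scale0r.
  transitivity T`_j.+1; last by rewrite nth_default.
  by rewrite TE mxE; apply: eq_bigr => i _; rewrite mxE.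
have inj (x : 'rV_r') : (forall j, n %| (x *m C) 0 j) -> forall i, n %| x 0 i.
  move=> h; have [|z [R hR]] := decomp x 0.
    by move=> j; rewrite [X in _ - X]mxE subr0.
  have s0 : \sum_(j < r') (0 : 'rV[A]_r') 0 j *: 'X^(j.+1) = 0 :> {poly A}.
    by apply: big1 => j _; rewrite mxE scale0r.
  rewrite s0 addr0 in hR.
  (* Hence [n] divides [z] and [V x] lies in [A[pi]]; its coordinates [x_i b'_i] are then divisible
     by [b_i = b'_i n], which gives [n %| x_i]. *)
  have e1 : phi z = phi n * (V x - ev R).
    by rewrite mulrBr VE hR evD ev_C ev_CM addrK.
  have /dvdpP [w zw] := phi_dvd e1.
  have e2 : V x = ev (w%:P + R).
    rewrite evD ev_C; apply: (skew_mulrI phi_n0).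
    by rewrite /= VE hR evD ev_C ev_CM zw mulrDr -rmorphM mulrC.
  move=> i; have [_ /(_ (ex_intro _ _ e2) i (ltn_ord i)) fV] := f_ker (cV x).
  have h1 := f_sum (fun i => x 0 i * b' i) ce (ltn_ord i).
  have {h1} := dvdp_sub fV h1; rewrite opprB addrCA subrr addr0 => h1.
  have : b i %| x 0 i * b' i.
    have h2 : b i %| \sum_j x 0 j * b' j * (f (e j) i - (j == i)%:R).
      by apply: (big_ind (fun a => b i %| a)) => [|a c|j _];
        [exact: dvdp0|exact: dvdp_add|exact: dvdp_mull].
    have := dvdp_sub h1 h2; rewrite -sumrB (bigD1 i) //= big1 => [|j ne].
      rewrite eqxx addr0 -[true%:R]/1; congr (_ %| _); ring.
    rewrite (negPf ne) -[false%:R]/0; ring.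
  by rewrite bE [x 0 i * _]mulrC dvdp_mul2l.
have [x hx] := mulmx_mod_onto n0 inj (delta_mx 0 (Ordinal r0)).
have [z [R hR]] := decomp _ _ hx.
have e1 : pi = phi (- z) + phi n * (V x - ev R).
  rewrite mulrBr VE hR (bigD1 (Ordinal r0)) //= big1 ?addr0; last first.
    by move=> j ne; rewrite mxE (negPf ne) andbF scale0r.
  rewrite mxE !eqxx scale1r expr1 !evD ev_C ev_X ev_CM addrK addrA.
  by rewrite -rmorphD addNr rmorph0 add0r.
have cu : GRing.comm g (V x - ev R).
  by apply: commrB => //; apply: ev_comm_pi.
have tr := minpoly_trace sg d_gt0 char_large monP evP minP cu e1.
(* Subtracting the trace relation for [a = - z] from the assumed congruence leaves [r (z + 1)]. *)
have /dvdpP [w zw] : n %| z + 1.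
  rewrite -(dvdpZr _ _ rK); have := dvdp_sub nP tr; congr (_ %| _).
  by rewrite -mul_polyC polyC_natr; ring.
exists (V x - ev R - phi w).
  by apply: commrB => //; apply: phi_comm.
rewrite mulrBr -rmorphM [n * w]mulrC -zw rmorphD rmorph1 [LHS]e1 rmorphN.
by rewrite [RHS]addrC opprD addrA subrK addrC.
Qed.
End RefinedIndex.

(** * Primes of the integral closure *)

Section FractionField.
Variable K : finFieldType.
Local Notation A := {poly K}.
Local Notation F := {fraction {poly K}}.

Lemma fraction_rep (x : F) : exists a b : A, b != 0 /\ x = a%:F / b%:F.
Proof.
elim/quotW: x => f; exists \n_f, \d_f; split; first exact: denom_ratioP.
have d0 : (\d_f)%:F != 0 :> F by rewrite tofrac_eq0 denom_ratioP.
apply: (mulIf d0); rewrite divfK //; unlock tofrac.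
rewrite -[LHS]FracField.pi_mul; apply/eqmodP => /=.
rewrite FracField.equivfE /FracField.mulf.
by rewrite !numden_Ratio ?(oner_neq0, mulr1, mul1r, denom_ratioP) // mulrC.
Qed.

Lemma fraction_coprime (x : F) :
  exists a b : A, [/\ b != 0, coprimep a b & x = a%:F / b%:F].
Proof.
have [a [b [b0 ->]]] := fraction_rep x.
set c := gcdp a b; have c0 : c != 0 by rewrite gcdp_eq0 negb_and b0 orbT.
have [ea eb] : a = a %/ c * c /\ b = b %/ c * c.
  by rewrite !divpK ?dvdp_gcdl ?dvdp_gcdr.
exists (a %/ c), (b %/ c); split.
- by apply: contraNneq b0 => h; rewrite eb h mul0r.
- by rewrite coprimep_div_gcd // b0 orbT.
rewrite {1}ea {1}eb !rmorphM /= -mulf_div divff ?mulr1 //.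
by rewrite tofrac_eq0.
Qed.

(** The rational root theorem: clearing denominators shows that [b] divides [a ^+ m], so the coprime
    denominator [b] is a unit. *)
Lemma fraction_integral (x : F) (Q : {poly A}) : Q \is monic ->
  root (map_poly (@tofrac A) Q) x -> exists a : A, x = a%:F.
Proof.
move=> mQ; have [a [b [b0 cab ->]]] := fraction_coprime x.
rewrite rootE horner_coef size_map_inj_poly; last first.
- exact: rmorph0.
- by move=> u v /eqP; rewrite tofrac_eq => /eqP.
have [m sQ] : exists m, size Q = m.+1.
  by exists (size Q).-1; rewrite prednK // lt0n size_poly_eq0 monic_neq0.
have lQ : Q`_m = 1 by rewrite -(monicP mQ) lead_coefE sQ.
rewrite sQ => /eqP rt.
have bF : b%:F != 0 :> F by rewrite tofrac_eq0.
have dv : b %| a ^+ m.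
  have : \sum_(i < m.+1) Q`_i * (a ^+ i * b ^+ (m - i)) = 0.
    apply/eqP; rewrite -tofrac_eq0 rmorph_sum; apply/eqP.
    have := congr1 ( *%R^~ (b%:F ^+ m)) rt; rewrite /= mul0r mulr_suml.
    apply: etrans; apply: eq_bigr => i _.
    rewrite coef_map !rmorphM !rmorphXn /= expr_div_n -!mulrA; congr (_ * (_ * _)).
    have lim : (i <= m)%N by rewrite -ltnS.
    have -> : b%:F ^+ m = b%:F ^+ i * b%:F ^+ (m - i) by rewrite -exprD subnKC.
    by rewrite mulKf ?expf_neq0.
  rewrite big_ord_recr /= subnn mulr1 lQ mul1r.
  move/eqP; rewrite addrC addr_eq0 => /eqP ->; rewrite dvdpNr.
  apply: (big_ind (fun c => b %| c)) => [|c e|i _]; [exact: dvdp0|exact: dvdp_add|].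
  rewrite dvdp_mull // dvdp_mull //.
  by rewrite -[(m - i)%N]prednK ?subn_gt0 // exprS dvdp_mulr.
have : b %| 1.
  rewrite -(Gauss_dvdpr 1 (_ : coprimep b (a ^+ m))) ?mulr1 //.
  by rewrite coprimep_sym coprimep_expl.
rewrite dvdp1 => /size_poly1P [c c0 bc]; exists (c^-1 *: a).
apply: (mulIf bF); rewrite divfK // -rmorphM bc /= mulrC mul_polyC scalerA divff //.
by rewrite scale1r.
Qed.
End FractionField.

Section Residue.
Variables (K : finFieldType) (p : {poly K}) (mi : monic_irreducible_poly p).
Local Notation A := {poly K}.
Local Notation k := (Fp mi).
(** An alias of [redA] that carries the structure of a ring morphism. *)
Definition red : A -> k := redA mi.
HB.instance Definition _ := GRing.RMorphism.copy red (in_qpoly p).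

Lemma val_red a : (red a : {poly K}) = a %% p.
Proof.
rewrite Pdiv.IdomainMonic.modpE ?mi.2 //.
by rewrite /red /redA /in_qpoly /= /mk_monic !mi.
Qed.

Lemma red_eq0 a : (red a == 0) = (p %| a).
Proof.
rewrite -[RHS]/(a %% p == 0) -val_red; apply/eqP/eqP => [-> //|h].
exact: val_inj.
Qed.

Lemma red_onto y : exists a, red a = y.
Proof.
exists (y : {poly K}); apply/val_inj => /=; apply: in_qpoly_small.
exact: size_mk_monic.
Qed.
Lemma Bezout_irred a : ~~ (p %| a) -> exists u v, u * p + v * a = 1.
Proof.
rewrite -(irreducible_poly_coprime _ mi.1) => /Bezout_eq1_coprimepP [[u v] h].
by exists u, v.
Qed.
End Residue.

Section PrimesAbove.
Variables (K : finFieldType) (L : fieldExtType {fraction {poly K}}).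
Local Notation A := {poly K}.
Local Notation emb := (embA L).
Local Notation intA := (@intA K L).
HB.instance Definition _ := GRing.RMorphism.copy emb (in_alg L \o @tofrac A).

Lemma emb_inj : injective emb.
Proof.
move=> a c e; apply/eqP; rewrite -tofrac_eq; apply/eqP.
exact: (fmorph_inj (in_alg L) e).
Qed.

Lemma intAP x : intA x <-> integralOver emb x.
Proof. by split=> [[Q []]|[Q]]; exists Q. Qed.

Lemma intA_emb a : intA (emb a).
Proof. exact/intAP/(integral_id emb). Qed.
Lemma intAD x y : intA x -> intA y -> intA (x + y).
Proof. by move=> /intAP ix /intAP iy; apply/intAP/(integral_add (RtoK := emb)). Qed.
Lemma intAB x y : intA x -> intA y -> intA (x - y).
Proof. by move=> /intAP ix /intAP iy; apply/intAP/(integral_sub (RtoK := emb)). Qed.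
Lemma intAM x y : intA x -> intA y -> intA (x * y).
Proof. by move=> /intAP ix /intAP iy; apply/intAP/(integral_mul (RtoK := emb)). Qed.
Lemma intA0 : intA 0. Proof. by rewrite -(rmorph0 emb); apply: intA_emb. Qed.
Lemma intA1 : intA 1. Proof. by rewrite -(rmorph1 emb); apply: intA_emb. Qed.
Lemma intA_prod (I : Type) (s : seq I) (Q : pred I) (G : I -> L) :
  (forall i, Q i -> intA (G i)) -> intA (\prod_(i <- s | Q i) G i).
Proof. by move=> h; apply: big_ind => //; [apply: intA1 | apply: intAM]. Qed.
Lemma intA_sum (I : Type) (s : seq I) (Q : pred I) (G : I -> L) :
  (forall i, Q i -> intA (G i)) -> intA (\sum_(i <- s | Q i) G i).
Proof. by move=> h; apply: big_ind => //; [apply: intA0 | apply: intAD]. Qed.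

Lemma intA_base x : x \in 1%VS -> intA x -> exists a, x = emb a.
Proof.
case/vlineP => c -> [Q [mQ rQ]]; have [|a ->] := @fraction_integral K c Q mQ.
  move: rQ; have -> : emb = in_alg L \o @tofrac A by [].
  by rewrite map_poly_comp fmorph_root.
by exists a.
Qed.

Variables (p : {poly K}) (mi : monic_irreducible_poly p).
Local Notation red := (red mi).
Variable P : L -> Prop.
Hypotheses (prP : prime_ideal_B P) (Pp : P (emb p)).

Lemma prime_int x : P x -> intA x. Proof. by case: prP => [[h _] _ _ _ _]; apply: h. Qed.
Lemma prime0 : P 0. Proof. by case: prP => [[]]. Qed.
Lemma primeD x y : P x -> P y -> P (x + y).
Proof. by case: prP => [_ h _ _ _]; apply: h. Qed.
Lemma primeMl x y : intA x -> P y -> P (x * y).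
Proof. by case: prP => [_ _ h _ _]; apply: h. Qed.
Lemma primeMr x y : P x -> intA y -> P (x * y).
Proof. by rewrite mulrC => hx hy; apply: primeMl. Qed.
Lemma prime_not1 : ~ P 1. Proof. by case: prP. Qed.
Lemma prime_mulP x y : intA x -> intA y -> P (x * y) -> P x \/ P y.
Proof. by case: prP => _ _ _ _; apply. Qed.
Lemma primeN x : P x -> P (- x).
Proof.
move=> Px; rewrite -mulN1r; apply: primeMl => //.
by rewrite -(rmorph1 emb) -rmorphN; apply: intA_emb.
Qed.
Lemma primeB x y : P x -> P y -> P (x - y).
Proof. by move=> Px Py; apply: primeD => //; apply: primeN. Qed.
Lemma prime_sum (I : Type) (s : seq I) (Q : pred I) (G : I -> L) :
  (forall i, Q i -> P (G i)) -> P (\sum_(i <- s | Q i) G i).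
Proof. by move=> h; apply: big_ind => //; [apply: prime0 | apply: primeD]. Qed.
Lemma prime_prod (I : eqType) (s : seq I) (G : I -> L) :
  (forall i, i \in s -> intA (G i)) -> P (\prod_(i <- s) G i) ->
  exists2 i, i \in s & P (G i).
Proof.
elim: s => [|i s IH] hi; first by rewrite big_nil => /prime_not1.
rewrite big_cons => /prime_mulP [||h|/IH []].
- by apply: hi; rewrite mem_head.
- rewrite big_seq; apply: intA_prod => j js; apply: hi.
  by rewrite inE js orbT.
- by exists i; rewrite ?mem_head.
- by move=> j js; apply: hi; rewrite inE js orbT.
by move=> j js Pj; exists j; rewrite // inE js orbT.
Qed.

(** By Bezout, an element of [A] outside [(p)] generates the unit ideal together with [p], while [P]
    does not contain 1. *)
Lemma prime_emb a : P (emb a) <-> p %| a.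
Proof.
split=> [Pa|/dvdpP [c ->]]; last first.
  by rewrite rmorphM; apply: primeMl => //; apply: intA_emb.
apply: contraT => /(Bezout_irred mi) [u [v uv]]; case: prime_not1.
rewrite -(rmorph1 emb) -uv rmorphD !rmorphM.
by apply: primeD; apply: primeMl => //; apply: intA_emb.
Qed.

(** The residue map modulo [P] is a relation, since it takes values in [A/p] only on elements
    congruent to elements of [A]. *)
Definition reduces (x : L) (y : Fp mi) := exists2 a, red a = y & P (x - emb a).

Lemma reduces_emb a : reduces (emb a) (red a).
Proof. by exists a => //; rewrite subrr; apply: prime0. Qed.

Lemma reduces_uniq x y y' : reduces x y -> reduces x y' -> y = y'.
Proof.
move=> [a <- Pa] [c <- Pc]; apply/eqP; rewrite -subr_eq0 -rmorphB red_eq0.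
apply/prime_emb; rewrite rmorphB.
have := primeB Pc Pa; congr (P _).
by rewrite opprB addrC addrA subrK.
Qed.

Lemma reducesD x x' y y' : reduces x y -> reduces x' y' -> reduces (x + x') (y + y').
Proof.
move=> [a <- Pa] [c <- Pc]; exists (a + c); first by rewrite rmorphD.
by rewrite rmorphD opprD addrACA; apply: primeD.
Qed.

Lemma reducesN x y : reduces x y -> reduces (- x) (- y).
Proof.
move=> [a <- Pa]; exists (- a); first by rewrite rmorphN.
by rewrite rmorphN -opprD; apply: primeN.
Qed.

Lemma reduces_int x y : reduces x y -> intA x.
Proof.
case=> a _ /prime_int h; rewrite -(subrK (emb a) x).
by apply: intAD => //; apply: intA_emb.
Qed.

Lemma reducesM x x' y y' : reduces x y -> reduces x' y' -> reduces (x * x') (y * y').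
Proof.
move=> [a <- Pa] h'; have ix' := reduces_int h'; case: h' => c <- Pc.
exists (a * c); first by rewrite rmorphM.
have -> : x * x' - emb (a * c) = (x - emb a) * x' + emb a * (x' - emb c).
  by rewrite mulrBl mulrBr rmorphM addrA subrK.
by apply: primeD; [apply: primeMr | apply: primeMl => //; apply: intA_emb].
Qed.

Lemma reduces_prod_XsubC (zs : seq L) (rho : L -> Fp mi) :
  (forall z, z \in zs -> reduces z (rho z)) ->
  forall i, reduces (\prod_(z <- zs) ('X - z%:P))`_i (\prod_(z <- zs) ('X - (rho z)%:P))`_i.
Proof.
have r0 : reduces 0 0 by have := reduces_emb 0; rewrite !rmorph0.
elim: zs => [|z zs IH] h i.
  rewrite !big_nil !coef1; case: (i == 0)%N => //=.
  by have := reduces_emb 1; rewrite !rmorph1.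
have hz : reduces z (rho z) by apply: h; rewrite mem_head.
have {}IH j : reduces (\prod_(z <- zs) ('X - z%:P))`_j
    (\prod_(z <- zs) ('X - (rho z)%:P))`_j.
  by apply: IH => w ws; apply: h; rewrite inE ws orbT.
rewrite !big_cons !mulrBl !coefB !coefXM !coefCM.
apply: reducesD; last by apply: reducesN; apply: reducesM.
by case: (i == 0)%N.
Qed.

(** Each coefficient of [H] reduces both directly and as a symmetric function of the roots; residues
    are unique. *)
Lemma reduces_roots (zs : seq L) (rho : L -> Fp mi) (H : {poly A}) :
  (forall z, z \in zs -> reduces z (rho z)) ->
  map_poly emb H = \prod_(z <- zs) ('X - z%:P) ->
  map_poly red H = \prod_(z <- zs) ('X - (rho z)%:P).
Proof.
move=> hz e; apply/polyP => i; rewrite coef_map /=.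
apply: (reduces_uniq (x := emb H`_i)); first exact: reduces_emb.
have -> : emb H`_i = (map_poly emb H)`_i by rewrite coef_map.
by rewrite e; apply: reduces_prod_XsubC.
Qed.

(** With [a_y] in [A] lifting [y], the product of all [z - a_y] is congruent to [H(z) = 0] modulo
    [P], so [P] contains a factor. *)
Lemma root_reduces (H : {poly A}) (z : L) (ys : seq (Fp mi)) :
  intA z -> root (map_poly emb H) z ->
  map_poly red H = \prod_(y <- ys) ('X - y%:P) ->
  exists2 y, y \in ys & reduces z y.
Proof.
move=> iz rz e.
have [lift liftK] : exists l : Fp mi -> A, forall y, red (l y) = y.
  have h (y : Fp mi) : exists a, red a == y.
    by have [a <-] := red_onto y; exists a.
  by exists (fun y => xchoose (h y)) => y; apply/eqP/(xchooseP (h y)).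
pose G := \prod_(y <- ys) ('X - (lift y)%:P).
have GE : map_poly red G = \prod_(y <- ys) ('X - y%:P).
  rewrite rmorph_prod; apply: eq_bigr => y _.
  by rewrite rmorphB /= map_polyX map_polyC /= liftK.
have : P (map_poly emb (G - H)).[z].
  rewrite horner_coef; apply: prime_sum => i _; apply: primeMr.
    rewrite coef_map; apply/prime_emb; rewrite -(red_eq0 mi) coefB rmorphB.
    have := congr1 (fun f : {poly Fp mi} => f`_i) (etrans GE (esym e)).
    by rewrite !coef_map /= => ->; rewrite subrr.
  have := @intA_prod _ (index_enum 'I_i) xpredT (fun=> z).
  by rewrite prodr_const card_ord; apply.
rewrite rmorphB hornerD hornerN (rootP rz) subr0 rmorph_prod.
rewrite horner_prod => /prime_prod [y _|y ys_y Py].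
  rewrite rmorphB /= map_polyX map_polyC !hornerE.
  by apply: intAB => //; apply: intA_emb.
exists y => //; exists (lift y); first exact: liftK.
by move: Py; rewrite rmorphB /= map_polyX map_polyC !hornerE.
Qed.
End PrimesAbove.

(** Choice along a finite sequence, by induction, for a relation that need not be decidable. *)
Lemma seq_choice (T : eqType) (U : Type) (R : T -> U -> Prop) (u0 : U) (s : seq T) :
  (forall z, z \in s -> exists u, R z u) ->
  exists f, forall z, z \in s -> R z (f z).
Proof.
elim: s => [|z s IH] h; first by exists (fun=> u0).
have [|f hf] := IH; first by move=> w ws; apply: h; rewrite inE ws orbT.
have [|u hu] := h z; first by rewrite mem_head.
exists (fun w => if w == z then u else f w) => w.
by rewrite inE; case: eqP => [->|_ /=]; auto.
Qed.

Lemma uniq_map_inj (T U : eqType) (f : T -> U) (s : seq T) :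
  uniq (map f s) -> {in s &, injective f}.
Proof.
elim: s => // z s IH /= /andP [nz us] a c; rewrite !inE.
case/predU1P=> [->|ha] /predU1P [->|hc] // e; last exact: IH.
  by case/mapP: nz; exists c.
by case/mapP: nz; exists a.
Qed.

(** * Residue degree and ramification through traces *)

Section SplitPrimes.
Variables (K : finFieldType) (L : splittingFieldType {fraction {poly K}}).
Local Notation A := {poly K}.
Local Notation emb := (embA L).
Local Notation intA := (@intA K L).
Variables (p : {poly K}) (mi : monic_irreducible_poly p).
Local Notation red := (red mi).
Variables (h : {poly A}) (zs : seq L) (ys : seq (Fp mi)).
Hypothesis h_monic : h \is monic.
Hypothesis zs_uniq : uniq zs.
Hypothesis h_zs : map_poly emb h = \prod_(z <- zs) ('X - z%:P).
Hypothesis zs_gen : <<1 & zs>>%VS = {:L}%VS.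
Hypothesis ys_uniq : uniq ys.
Hypothesis h_ys : map_poly red h = \prod_(y <- ys) ('X - y%:P).
Variable P : L -> Prop.
Hypotheses (prP : prime_ideal_B P) (Pp : P (emb p)).

Local Notation G := 'Gal({:L} / 1)%g.
Local Notation Tr := (galTrace 1 {:L}).

Lemma root_zs z : root (map_poly emb h) z = (z \in zs).
Proof. by rewrite h_zs root_prod_XsubC. Qed.

Lemma zs_int z : z \in zs -> intA z.
Proof. by rewrite -root_zs; exists h. Qed.

Lemma galois_zs : galois 1 {:L}.
Proof.
apply/splitting_galoisField; exists (map_poly emb h); split.
- apply/polyOverP => i; rewrite coef_map /=; exact: rpredZ (mem1v _).
- by rewrite h_zs separable_prod_XsubC.
by exists zs => //; rewrite h_zs eqpxx.
Qed.

Lemma gal_emb (s : gal_of {:L}) a : s \in G -> s (emb a) = emb a.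
Proof. by move=> sG; apply: (fixed_gal (sub1v _) sG); apply: rpredZ (mem1v _). Qed.

Lemma gal_map (s : gal_of {:L}) (Q : {poly A}) : s \in G ->
  map_poly s (map_poly emb Q) = map_poly emb Q.
Proof.
move=> sG; rewrite -map_poly_comp; apply: eq_map_poly => a /=.
exact: gal_emb.
Qed.

Lemma gal_int (s : gal_of {:L}) x : s \in G -> intA x -> intA (s x).
Proof.
by move=> sG [Q [mQ rQ]]; exists Q; split=> //; rewrite -(gal_map Q sG) rmorph_root.
Qed.

Lemma gal_zs (s : gal_of {:L}) z : s \in G -> z \in zs -> s z \in zs.
Proof. by move=> sG; rewrite -!root_zs -{2}(gal_map h sG); apply: rmorph_root. Qed.

Lemma gal_moves (s : gal_of {:L}) : s \in G -> s != 1%g ->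
  exists2 z, z \in zs & s z != z.
Proof.
move=> sG s1; apply/hasP; apply: contraT => /hasPn fx; case/negP: s1.
apply/gal_eqP => x _; rewrite gal_id.
have : (<<1 & zs>> <= fixedField [set s])%VS.
  apply/Fadjoin_seqP; split; first exact: sub1v.
  move=> z /fx /negPn /eqP sz; apply/fixedFieldP; first exact: memvf.
  by move=> t /set1P ->.
rewrite zs_gen => /subvP /(_ x (memvf _)) /fixedFieldP.
by move/(_ (memvf _)); apply; rewrite set11.
Qed.

Lemma trace_int x : intA x -> exists a, Tr x = emb a.
Proof.
move=> ix; apply: intA_base; first exact: mem_galTrace galois_zs (memvf _).
by apply: intA_sum => s sG; apply: gal_int.
Qed.

Lemma traceZ a x : Tr (emb a * x) = emb a * Tr x.
Proof.
by rewrite /galTrace mulr_sumr; apply: eq_bigr => s sG; rewrite rmorphM /= gal_emb.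
Qed.

(* With [E z] the product of all [a_z - z'] for [z' <> z], where [a_z] in [A] is
   congruent to [z], the witness is the square of [\prod_z E z]: if [t = s z]
   differs from [z] then [E t * s (E t)] is a multiple of [h(a_t)], hence of [p]. *)
Lemma separating_element : exists y, [/\ intA y, ~ P y &
  forall s : gal_of {:L}, s \in G -> s != 1%g ->
    exists2 w, intA w & y * s y = emb (p ^+ 2) * w].
Proof.
have [rho hrho] : exists rho : L -> A, forall z, z \in zs -> P (z - emb (rho z)).
  apply: (seq_choice (R := fun z a => P (z - emb a)) 0) => z zz.
  have [|y _ [a _ Pa]] := root_reduces prP Pp (zs_int zz) _ h_ys.
    by rewrite root_zs.
  by exists a.
have h_rho : map_poly red h = \prod_(z <- zs) ('X - (red (rho z))%:P).
  by apply: (reduces_roots prP Pp _ h_zs) => z zz; exists (rho z) => //; apply: hrho.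
(* The reduction of [h] has simple roots, so the [rho z] are pairwise incongruent modulo [p]. *)
have rho_inj : {in zs &, injective (fun z => red (rho z))}.
  apply: uniq_map_inj; rewrite -separable_prod_XsubC big_map -h_rho h_ys.
  by rewrite separable_prod_XsubC.
have irho z z' : z' \in zs -> intA (emb (rho z) - z').
  by move=> zz; apply: intAB; [apply: intA_emb | apply: zs_int].
pose E z := \prod_(z' <- zs | z' != z) (emb (rho z) - z').
have iE z : intA (E z).
  by rewrite /E big_seq_cond; apply: intA_prod => z' /andP [zz _]; apply: irho.
have iprod (Q : pred L) : intA (\prod_(z <- zs | Q z) E z) by apply: intA_prod.
pose y := \prod_(z <- zs) E z; have iy : intA y by apply: iprod.
have nPy : ~ P y.
  move=> /(prime_prod prP) [|z zz]; first by move=> z _; apply: iE.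
  rewrite /E -big_filter => /(prime_prod prP) [z'|z'].
    by rewrite mem_filter => /andP [_]; apply: irho.
  rewrite mem_filter => /andP [ne zz'] Pz; case/eqP: ne.
  apply: (rho_inj _ _ zz' zz); apply: (reduces_uniq prP Pp (x := z')).
    by exists (rho z') => //; apply: hrho.
  exists (rho z) => //; rewrite -opprB; exact: primeN.
exists (y ^+ 2); split.
- by rewrite expr2; apply: intAM.
- by rewrite expr2 => /(prime_mulP prP) [].
move=> s sG s1; have [z zz sz] := gal_moves sG s1.
set t := s z in sz; have tt : t \in zs by apply: gal_zs.
have [c hc] : exists c, h.[rho t] = c * p.
  apply/dvdpP; rewrite -(red_eq0 mi) -horner_map -rootE h_rho.
  rewrite -(big_map (fun z => red (rho z)) xpredT (fun y => 'X - y%:P)).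
  by rewrite root_prod_XsubC; apply: map_f.
have Et : E t * (emb (rho t) - t) = emb p * emb c.
  rewrite -rmorphM mulrC -[p * c]mulrC -hc -horner_map h_zs horner_prod.
  rewrite (bigD1_seq t) //= !hornerE; congr (_ * _).
  by apply: eq_bigr => z' _; rewrite !hornerE.
pose R1 := \prod_(z <- zs | z != t) E z.
have yE : y = E t * R1 by rewrite /y (bigD1_seq t).
pose R2 := \prod_(z' <- zs | (z' != t) && (z' != z)) (emb (rho t) - z').
have EE : E t = (emb (rho t) - z) * R2.
  rewrite /E -big_filter (bigD1_seq z) ?filter_uniq //=; last first.
    by rewrite mem_filter eq_sym sz.
  by congr (_ * _); rewrite big_filter_cond.
(* The factor [a_t - z] of [E t] is sent by [s] to [a_t - t], the factor of [h(a_t)] missing from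
   [E t]. *)
have sE : s (E t) = (emb (rho t) - t) * s R2.
  by rewrite EE rmorphM rmorphB /= gal_emb.
have key : y * s y = emb p * (emb c * R1 * (s R2 * s R1)).
  by rewrite mulrA mulrA -Et yE rmorphM /= sE; ring.
have iR2 : intA R2.
  by rewrite /R2 big_seq_cond; apply: intA_prod => z' /andP [zz' _]; apply: irho.
exists ((emb c * R1 * (s R2 * s R1)) ^+ 2); last first.
  by rewrite !rmorphXn /= -!exprMn key.
have iR1 : intA R1 by apply: iprod.
have iw : intA (emb c * R1 * (s R2 * s R1)).
  by apply: intAM; apply: intAM => //; [apply: intA_emb|apply: gal_int|apply: gal_int].
by rewrite expr2; apply: intAM.
Qed.

(** For [s] other than the identity, [P] contains [y * s y] but not [y], so it contains [s y]; only
    the identity term of the trace survives. *)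
Lemma trace_mod y x : intA x -> ~ P y -> intA y ->
  (forall s : gal_of {:L}, s \in G -> s != 1%g ->
    exists2 w, intA w & y * s y = emb (p ^+ 2) * w) ->
  P (Tr (y * x) - y * x).
Proof.
move=> ix nPy iy hy; rewrite /galTrace (bigD1 1%g) ?group1 //= gal_id.
rewrite addrAC subrr add0r; apply: prime_sum => // s /andP [sG s1].
rewrite rmorphM; apply: primeMr; [exact: prP| |exact: gal_int].
have [w iw e] := hy s sG s1.
have : P (y * s y).
  rewrite e; apply: (primeMr prP) => //; apply/(prime_emb mi prP Pp).
  by rewrite expr2 dvdp_mulr.
by case/(prime_mulP prP) => //; apply: gal_int.
Qed.

(** The traces [c] of [y] and [a] of [y * x] lie in [A] and are congruent to [y] and [y * x]. As [c]
    is prime to [p], with inverse [v] modulo [p], the element [x] is congruent to [v * a]. *)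
Lemma residue_degree1 x : intA x -> exists a, P (x - emb a).
Proof.
have [y [iy nPy hy]] := separating_element => ix.
have [c hc] := trace_int iy; have [a ha] := trace_int (intAM iy ix).
have Pc : P (emb c - y).
  by have := trace_mod (@intA1 K L) nPy iy hy; rewrite mulr1 hc.
have Pa : P (emb a - y * x) by have := trace_mod ix nPy iy hy; rewrite ha.
have /(Bezout_irred mi) [u [v uv]] : ~~ (p %| c).
  apply/negP => /(prime_emb mi prP Pp) Pc'; apply: nPy.
  by have := primeB prP Pc' Pc; rewrite subKr.
exists (v * a).
have -> : x - emb (v * a) = emb u * emb p * x + emb v * (x * (emb c - y) - (emb a - y * x)).
  have e1 : emb u * emb p + emb v * emb c = 1 by rewrite -!rmorphM -rmorphD uv rmorph1.
  by rewrite rmorphM -{1}[x]mul1r -e1; ring.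
apply: (primeD prP).
  by apply: (primeMr prP) => //; apply: (primeMl prP) => //; apply: intA_emb.
apply: (primeMl prP); first exact: intA_emb.
by apply: (primeB prP) => //; apply: (primeMl prP).
Qed.

(** For [x1], [x2] in [P], the trace of [(y x1) (y x2)] is modulo [p^2] the product of the traces of
    the factors, both divisible by [p]. If [p] were in the square of [P], then [p^2] would divide
    [Tr (p y^2)], so [Tr (y^2)] and with it [y^2] would lie in [P]. *)
Lemma unramified : ~ in_sq P (emb p).
Proof.
have [y [iy nPy hy]] := separating_element => -[s [sP ep]].
have tr x : P x -> exists a, Tr (y * x) = emb (p * a).
  move=> Px; have ix := prime_int prP Px.
  have [c hc] := trace_int (intAM iy ix).
  suff /dvdpP [a ca] : p %| c by exists a; rewrite hc ca mulrC.
  apply/(prime_emb mi prP Pp); rewrite -hc.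
  have := primeD prP (trace_mod ix nPy iy hy) (primeMl prP iy Px).
  by rewrite subrK.
have trM x1 x2 : P x1 -> P x2 -> exists2 w, intA w &
    Tr (y * x1 * (y * x2)) = emb (p ^+ 2) * w.
  move=> P1 P2; have [i1 i2] := (prime_int prP P1, prime_int prP P2).
  have [a1 e1] := tr _ P1; have [a2 e2] := tr _ P2.
  (* Every term of the trace other than that of the identity brings in some [y * t y], a multiple of
     [p^2]. *)
  have [w iw ew] : exists2 w, intA w &
      y * x1 * Tr (y * x2) = y * x1 * (y * x2) + emb (p ^+ 2) * w.
    pose f (t : gal_of {:L}) (w : L) := intA w /\ y * t y = emb (p ^+ 2) * w.
    have [u hu] : exists u, forall t, t \in enum (G :\ 1%g) -> f t (u t).
      apply: (seq_choice (R := f) 0) => t; rewrite mem_enum in_setD1 => /andP [t1 tG].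
      by have [w iw ew] := hy t tG t1; exists w.
    exists (\sum_(t in G :\ 1%g) x1 * t x2 * u t).
      apply: intA_sum => t tG; have [it _] := hu t (etrans (mem_enum _ _) tG).
      have {}tG : t \in G by case/setD1P: tG.
      by apply: intAM => //; apply: intAM => //; apply: gal_int.
    rewrite /galTrace (bigD1 1%g) ?group1 //= gal_id mulrDr; congr (_ + _).
    rewrite !mulr_sumr; apply: eq_big => [t|t /andP [tG t1]].
      by rewrite in_setD1 andbC.
    have [|_ et] := hu t; first by rewrite mem_enum in_setD1 t1.
    rewrite rmorphM /=.
    have -> : y * x1 * (t y * t x2) = y * t y * (x1 * t x2) by ring.
    by rewrite et; ring.
  have [c hc] := trace_int iw.
  exists (emb (a1 * a2) - emb c); first by apply: intAB; apply: intA_emb.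
  have : Tr (emb (p * a2) * (y * x1)) = Tr (y * x1 * (y * x2) + emb (p ^+ 2) * w).
    by rewrite -ew e2 mulrC.
  rewrite traceZ raddfD /= traceZ hc e1 => e3.
  apply: (addIr (emb (p ^+ 2) * emb c)); rewrite -e3 -!rmorphM -rmorphB -!rmorphM -rmorphD.
  by congr (emb _); ring.
have [w iw ew] : exists2 w, intA w & Tr (emb p * y ^+ 2) = emb (p ^+ 2) * w.
  rewrite ep mulr_suml; elim: s sP {ep} => [|z s IH] sP.
    by exists 0; [exact: intA0 | rewrite big_nil raddf0 mulr0].
  have [|w iw ew] := IH; first by move=> t ts; apply: sP; rewrite inE ts orbT.
  have [|P1 P2] := sP z; first by rewrite mem_head.
  have [w' iw' ew'] := trM _ _ P1 P2; exists (w' + w); first exact: intAD.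
  rewrite big_cons raddfD /= ew mulrDr -ew'; congr (Tr _ + _); ring.
have e2 : Tr (y ^+ 2) = emb p * w.
  have p0 : emb p != 0.
    by rewrite -(rmorph0 emb) (inj_eq (@emb_inj K L)); case: mi => _ /monic_neq0.
  by apply: (mulfI p0); rewrite -traceZ ew expr2 rmorphM /= mulrA.
suff : P (y * y) by case/(prime_mulP prP).
have P2 : P (Tr (y ^+ 2)) by rewrite e2; apply: (primeMr prP).
by have := primeB prP P2 (trace_mod iy nPy iy hy); rewrite -expr2 subKr.
Qed.
End SplitPrimes.

(** * Existence of a prime above [p] *)

Section ExistencePrime.
Variables (K : finFieldType) (L : fieldExtType {fraction {poly K}}).
Local Notation A := {poly K}.
Local Notation emb := (embA L).
Local Notation intA := (@intA K L).
Variables (p : {poly K}) (mi : monic_irreducible_poly p).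

Let ideal (I : L -> Prop) := [/\ (forall x, I x -> intA x) /\ I (emb p),
  (forall x y, I x -> I y -> I (x + y)),
  (forall x y, intA x -> I y -> I (x * y)) & ~ I 1].

(** A proper ideal containing [p] that is maximal for inclusion is prime. The ideal generated by [p]
    is proper because an integral inverse of [p] would lie in [A]. *)
Lemma prime_ideal_exists : exists P, prime_ideal_B P /\ P (emb p).
Proof.
pose I0 (x : L) := exists2 w, intA w & x = emb p * w.
have id0 : ideal I0.
  split; first split.
  - by move=> x [w iw ->]; apply: intAM => //; apply: intA_emb.
  - by exists 1; rewrite ?mulr1 //; apply: intA1.
  - by move=> x y [w iw ->] [v iv ->]; exists (w + v); rewrite ?mulrDr //; apply: intAD.
  - by move=> x y ix [w iw ->]; exists (x * w); [apply: intAM|rewrite mulrCA].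
  move=> [w iw e].
  have [|a wa] := @intA_base K L w _ iw.
    have -> : w = (p%:F)^-1%:A.
      have p0 : emb p != 0 by apply/eqP => h; move/eqP: e; rewrite h mul0r oner_eq0.
      apply: (mulfI p0); rewrite -e -[emb p]/(in_alg L p%:F) -rmorphM /=.
      by rewrite mulfV ?scale1r // -(fmorph_eq0 (in_alg L)).
    exact: rpredZ (mem1v _).
  move: e; rewrite wa -rmorphM -(rmorph1 emb) => /emb_inj e.
  have : p %| 1 by rewrite e dvdp_mulr.
  by rewrite dvdp1; case: mi => [[sp _] _]; rewrite gtn_eqF.
pose Q (I : L -> Prop) := (forall x, ~ I x) \/ ideal I.
have [|M [QM maxM]] := @classical_sets.Zorn_bigcup L Q.
  move=> C CQ Ctot; rewrite /classical_sets.bigcup /classical_sets.mkset.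
  have [ne|e] := boolp.pselect (exists2 I, C I & exists x, I x); last first.
    by left=> x [I CI Ix]; apply: e; exists I => //; exists x.
  right; have Cid I x : C I -> I x -> ideal I by move=> /CQ [] // h /h.
  case: ne => I CI [x Ix]; have [[hI Ip] _ _ _] := Cid I x CI Ix.
  split; first split.
  - by move=> y [J CJ Jy]; have [[h _] _ _ _] := Cid J y CJ Jy; apply: h.
  - by exists I.
  - move=> y z [J1 C1 Jy] [J2 C2 Jz].
    have [h|h] := Ctot _ _ C1 C2.
      by exists J2 => //; have [_ D _ _] := Cid J2 z C2 Jz; apply: D => //; apply: h.
    by exists J1 => //; have [_ D _ _] := Cid J1 y C1 Jy; apply: D => //; apply: h.
  - move=> y z iy [J CJ Jz]; exists J => //.
    by have [_ _ D _] := Cid J z CJ Jz; apply: D.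
  by move=> [J CJ J1]; have [_ _ _ nJ] := Cid J 1 CJ J1; apply: nJ.
have idM : ideal M.
  case: QM => // M0; case: (maxM I0); last by right.
  split=> [x /M0 //|h].
  by apply: (M0 (emb p)); apply: h; have [[]] := id0.
exists M; have [[Mint Mp] MD MM M1] := idM; split=> //.
have max J : ideal J -> (forall x, M x -> J x) -> forall x, J x -> M x.
  move=> idJ MJ x Jx; apply: boolp.contrapT => nMx; case: (maxM J); last by right.
  by split=> // h; apply: nMx; apply: h.
have MN x : M x -> M (- x).
  move=> Mx; rewrite -mulN1r; apply: MM => //.
  by rewrite -(rmorph1 emb) -rmorphN; apply: intA_emb.
split=> //.
- by split=> //; rewrite -(mul0r (emb p)); apply: MM => //; apply: intA0.
move=> x y ix iy Mxy; apply: boolp.contrapT => /boolp.not_orP [nx ny].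
(* By maximality, the ideal generated by [M] and [z] contains 1. *)
have key z : intA z -> ~ M z -> exists m w, [/\ M m, intA w & 1 = m + z * w].
  move=> iz nz; apply: boolp.contrapT => no; apply: nz.
  pose J u := exists m w, [/\ M m, intA w & u = m + z * w].
  apply: (max J).
  - split; first split.
    + by move=> u [m [w [Mm iw ->]]]; apply: intAD; [apply: Mint|apply: intAM].
    + by exists (emb p), 0; split; rewrite ?mulr0 ?addr0 //; apply: intA0.
    + move=> u v [m [w [Mm iw ->]]] [m' [w' [Mm' iw' ->]]].
      exists (m + m'), (w + w'); split; [exact: MD|exact: intAD|ring].
    + move=> u v iu [m [w [Mm iw ->]]].
      exists (u * m), (u * w); split; [exact: MM|exact: intAM|ring].
    by [].
  - by move=> u Mu; exists u, 0; split; rewrite ?mulr0 ?addr0 //; apply: intA0.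
  exists 0, 1; split; [|exact: intA1|ring].
  by rewrite -(mul0r (emb p)); apply: MM => //; apply: intA0.
have [m [w [Mm iw e1]]] := key x ix nx.
have [m' [w' [Mm' iw' e2]]] := key y iy ny.
apply: M1; rewrite -[1]mulr1 {1}e1 e2.
have -> : (m + x * w) * (m' + y * w')
  = (m' + y * w') * m + x * w * m' + w * w' * (x * y) by ring.
have iz : intA (m' + y * w') by rewrite -e2; apply: intA1.
by apply: (MD); first apply: (MD); apply: (MM) => //; apply: intAM.
Qed.
End ExistencePrime.

(** * Additive polynomials and reduction modulo p *)

Section AdditivePolynomials.
Variables (K : finFieldType) (R : fieldType) (iota : {rmorphism K -> R}).
Local Notation q := #|K|.
Local Notation S := (skewpoly iota).

Lemma card_eq0 : q%:R = 0 :> R.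
Proof.
have [p pr ch] := finPcharP K; have chR : p \in [pchar R] by rewrite (rmorph_pchar iota).
apply/eqP; rewrite -(dvdn_pcharf chR).
have := card_pnat iota; rewrite (eq_pnat _ (pcharf_eq chR)) => /p_natP [[|m] qE].
  by have := card_gt1 K; rewrite qE.
by rewrite qE expnS dvdn_mulr.
Qed.

(** The exponents [q ^ i] with [i > 0] vanish in [R], so only the linear term contributes. *)
Lemma deriv_qpoly (u : {poly R}) : (qpoly_of q u)^`() = (u`_0)%:P.
Proof.
elim/poly_mono_ind: u => [|u v Hu Hv|c i].
- by rewrite qpolyE linear0 deriv0 coef0.
- by rewrite qpolyE linearD /= derivD -!qpolyE Hu Hv coefD polyCD.
rewrite qpolyE linXn derivZ derivXn coefZ coefXn; case: i => [|i].
  by rewrite expn0 mulr1 expr0 mulr1n alg_polyC.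
by rewrite expnS -mulr_natr natrM -polyC_natr card_eq0 polyC0 mul0r mulr0 scaler0 mulr0 polyC0.
Qed.

Lemma qpoly_separable (u : {poly R}) : u`_0 != 0 -> separable_poly (qpoly_of q u).
Proof.
move=> u0; rewrite unlock deriv_qpoly -[_%:P]mulr1 mul_polyC.
by rewrite coprimepZr // coprimep1.
Qed.

Lemma size_qpoly (u : {poly R}) : u != 0 ->
  size (qpoly_of q u) = (q ^ (size u).-1).+1.
Proof.
move=> u0; have [m sm] : exists m, size u = m.+1.
  by exists (size u).-1; rewrite prednK // lt0n size_poly_eq0.
have le : (size u <= m.+1)%N by rewrite sm.
have um : u`_m != 0 by rewrite -[m]/(m.+1.-1) -sm -lead_coefE lead_coef_eq0.
rewrite qpolyE (linE _ le) big_ord_recr /= addrC size_polyDl size_scale // size_polyXn ?sm //.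
apply: (big_ind (fun f : {poly R} => size f < (q ^ m).+1)%N) => [|a b ha hb|i _].
- by rewrite size_poly0.
- by rewrite (leq_ltn_trans (size_polyD _ _)) // gtn_max ha.
rewrite (leq_ltn_trans (size_scale_leq _ _)) // size_polyXn ltnS.
by rewrite ltn_exp2l // card_gt1.
Qed.

Lemma qpoly_root0 (u : {poly R}) : root (qpoly_of q u) 0.
Proof.
elim/poly_mono_ind: u => [|u v /rootP Hu /rootP Hv|c i].
- by rewrite qpolyE linear0 root0.
- by apply/rootP; rewrite qpolyE linearD /= hornerD -!qpolyE Hu Hv addr0.
by rewrite qpolyE linXn rootE !hornerE expr0n eqn0Ngt expq_gt0 mulr0.
Qed.

(** The leading term of [v] is cancelled by [c tau^e w], where [c] divides by the leading
    coefficient of [w] twisted by [tau^e]. *)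
Lemma skew_rdiv (v w : S) : w != 0 -> exists u s : S, v = u * w + s /\
  (size (s : {poly R}) < size (w : {poly R}))%N.
Proof.
move=> w0; have [m] := ubnP (size (v : {poly R})); elim: m v => // m IH v /ltnSE lev.
have [lt|le] := ltnP (size (v : {poly R})) (size (w : {poly R})).
  by exists 0, v; rewrite mul0r add0r.
set t := size (v : {poly R}) in lev le; set e := (t - size (w : {poly R}))%N.
have sw : (0 < size (w : {poly R}))%N by rewrite lt0n size_poly_eq0.
have t0 : (0 < t)%N by apply: leq_trans le.
pose c := (v : {poly R})`_t.-1 / frobenius iota e (lead_coef (w : {poly R})).
pose x : S := c *: 'X^e : {poly R}.
have xw : (x * w : {poly R}) = c *: (map_poly (frobenius iota e) (w : {poly R}) * 'X^e).
  by rewrite skewM (tmulXn iota).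
have es : (e + size (w : {poly R}) = t)%N by rewrite subnK.
have [|u [s [E hs]]] := IH (v - x * w).
  rewrite (leq_trans _ lev) // -[t]prednK // ltnS; apply/leq_sizeP => j lej.
  have [jl|jl] := ltnP j t; last first.
    rewrite coefB xw coefZ coefMXn nth_default // ifF; last first.
      by apply/negbTE; rewrite -leqNgt (leq_trans _ jl) // -es leq_addr.
    rewrite [X in c * X]nth_default ?mulr0 ?subr0 // size_map_poly.
    by rewrite leq_subRL -?es // ?(leq_trans _ jl) // -es ?leq_addr.
  have -> : j = t.-1 by apply/eqP; rewrite eqn_leq lej -ltnS prednK // jl.
  have te : (t.-1 - e = (size (w : {poly R})).-1)%N.
    by rewrite -es -[in LHS](prednK sw) addnS /= addKn.
  rewrite coefB xw coefZ coefMXn ifF ?te; last first.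
    by apply/negbTE; rewrite -leqNgt -es -[size (w : {poly R})]prednK // addnS leq_addr.
  rewrite coef_map /= -lead_coefE /c divfK ?subrr //.
  by rewrite fmorph_eq0 lead_coef_eq0.
exists (u + x), s; split=> //.
by rewrite mulrDl addrAC -E subrK.
Qed.
End AdditivePolynomials.

(** The remainder of [tau^d - 1] by [w] vanishes at the roots of [w(x)], which lie in [k] where
    [x^(q^d) = x]. These are [q ^ deg w] distinct roots, more than a nonzero remainder can have. *)
Lemma Frobenius_factor (K k : finFieldType) (iota : {rmorphism K -> k}) d
    (w : skewpoly iota) (ys : seq k) :
  #|k| = (#|K| ^ d)%N -> w != 0 -> uniq ys ->
  qpoly_of #|K| w %= \prod_(y <- ys) ('X - y%:P) ->
  exists u : skewpoly iota, ('X^d - 1 : {poly k}) = u * w.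
Proof.
move=> ck w0 uy wy.
have [u [s [E hs]]] := skew_rdiv ('X^d - 1 : {poly k}) w0.
exists u; rewrite E; suff -> : s = 0 by rewrite addr0.
apply/eqP; apply: contraT => s0.
have sw := @size_qpoly K k w w0; have ss := @size_qpoly K k s s0.
have szy : size ys = (#|K| ^ (size (w : {poly k})).-1)%N.
  by move: (eqp_size wy); rewrite sw size_prod_XsubC => -[].
have : (size ys < size (qpoly_of #|K| s))%N.
  apply: max_poly_roots => //; first by rewrite -size_poly_eq0 ss.
  apply/allP => y yy.
  have ry : root (qpoly_of #|K| w) y by rewrite (eqp_root wy) root_prod_XsubC.
  have : (qpoly_of #|K| ('X^d - 1 : {poly k})).[y] = 0.
    have -> : 'X^d - 1 = 1 *: 'X^d + (-1) *: 'X^0 :> {poly k}.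
      by rewrite scale1r scaleN1r expr0.
    rewrite qpolyE linearD /= !linXn expn0 -ck !hornerE /= expf_card.
    by rewrite ?mul1r ?mulN1r subrr.
  have -> : qpoly_of #|K| ('X^d - 1 : {poly k})
      = qpoly_of #|K| (u * w) + qpoly_of #|K| s.
    by rewrite E; apply: (linearD (lin (fun i => 'X^(#|K| ^ i)))).
  rewrite qpoly_comp hornerD.
  by rewrite horner_comp (rootP ry) (rootP (qpoly_root0 _ _)) // add0r => /rootP.
rewrite szy ss ltnS leqNgt ltn_exp2l ?card_gt1 //.
have : (0 < size (s : {poly k}))%N by rewrite lt0n size_poly_eq0.
move: hs; case: (size (s : {poly k})) => // a.
by case: (size (w : {poly k})) => // b; rewrite ltnS /= => ->.
Qed.

(** As [x] divides [u(x)], the polynomial [w(x)] divides [u(w(x)) = x^(q^d) - x], the product of all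
    [x - c] with [c] in [k]. *)
Lemma Frobenius_factor_split (K k : finFieldType) (iota : {rmorphism K -> k}) d
    (u w : skewpoly iota) :
  #|k| = (#|K| ^ d)%N -> ('X^d - 1 : {poly k}) = u * w ->
  exists2 ys, uniq ys & qpoly_of #|K| w %= \prod_(y <- ys) ('X - y%:P).
Proof.
move=> ck E.
have dv : qpoly_of #|K| w %| 'X^#|k| - 'X.
  have -> : 'X^#|k| - 'X = qpoly_of #|K| ('X^d - 1 : {poly k}).
    have -> : 'X^d - 1 = 1 *: 'X^d + (-1) *: 'X^0 :> {poly k}.
      by rewrite scale1r scaleN1r expr0.
    by rewrite qpolyE linearD /= !linXn expn0 -ck scale1r scaleN1r.
  have := qpoly_root0 K (u : {poly k}); rewrite root_factor_theorem subr0.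
  move/dvdpP => [v hv]; rewrite E qpoly_comp hv comp_polyM comp_polyX.
  exact: dvdp_mull.
rewrite finField_genPoly in dv.
rewrite -(big_map id xpredT (fun x => 'X - x%:P)) in dv.
have [m hm] := dvdp_prod_XsubC dv; exists (mask m [seq i | i <- index_enum k]) => //.
by rewrite mask_uniq // map_id index_enum_uniq.
Qed.

Section Reduction.
Variables (K : finFieldType) (p : {poly K}) (mi : monic_irreducible_poly p).
Local Notation A := {poly K}.
Local Notation F := {fraction {poly K}}.
Local Notation k := (Fp mi).
Local Notation red := (red mi).
Local Notation q := #|K|.

Definition constF : K -> F := (@tofrac A) \o polyC.
Definition constP : K -> k := red \o polyC.
HB.instance Definition _ := GRing.RMorphism.on constF.
HB.instance Definition _ := GRing.RMorphism.on constP.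

Lemma prime_dvdM a c : p %| a * c = (p %| a) || (p %| c).
Proof. by rewrite -!(red_eq0 mi) rmorphM mulf_eq0. Qed.

Lemma not_dvd_neq0 a : ~~ (p %| a) -> a%:F != 0 :> F.
Proof. by rewrite tofrac_eq0; apply: contraNneq => ->; apply: dvdp0. Qed.

Lemma red_relD x x' (y y' : k) : red_rel x y -> red_rel x' y' -> red_rel (x + x') (y + y').
Proof.
move=> [a [b [nb [-> e]]]] [a' [b' [nb' [-> e']]]].
exists (a * b' + a' * b), (b * b'); split; last split.
- by rewrite prime_dvdM negb_or nb.
- by rewrite addf_div ?not_dvd_neq0 // !rmorphD !rmorphM.
change (redA mi) with red in *; rewrite !(rmorphD, rmorphM) /= -e -e'; ring.
Qed.

Lemma red_relM x x' (y y' : k) : red_rel x y -> red_rel x' y' -> red_rel (x * x') (y * y').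
Proof.
move=> [a [b [nb [-> e]]]] [a' [b' [nb' [-> e']]]].
exists (a * a'), (b * b'); split; last split.
- by rewrite prime_dvdM negb_or nb.
- by rewrite mulf_div !rmorphM.
change (redA mi) with red in *; rewrite !rmorphM /= -e -e'; ring.
Qed.

Lemma red_rel_tofrac a : red_rel a%:F (red a).
Proof.
exists a, 1; split; last split.
- by rewrite dvdp1; case: mi => [[sp _] _]; rewrite gtn_eqF.
- by rewrite rmorph1 divr1.
by change (redA mi) with red; rewrite rmorph1 mulr1.
Qed.

Lemma red_rel_uniq x (y y' : k) : red_rel x y -> red_rel x y' -> y = y'.
Proof.
move=> [a [b [nb [-> e]]]] [a' [b' [nb' [/eqP e1 e']]]].
move: e1; rewrite eqr_div ?not_dvd_neq0 // -!rmorphM tofrac_eq => /eqP e1.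
change (redA mi) with red in *.
have rb : red b != 0 by rewrite red_eq0.
have rb' : red b' != 0 by rewrite red_eq0.
apply: (mulIf rb); apply: (mulIf rb').
by rewrite e -rmorphM e1 rmorphM /= -e' mulrAC.
Qed.

Lemma red_relX x (y : k) m : red_rel x y -> red_rel (x ^+ m) (y ^+ m).
Proof.
move=> xy; elim: m => [|m IH]; last by rewrite !exprS; apply: red_relM.
by rewrite !expr0 -(rmorph1 (@tofrac A)) -(rmorph1 red); apply: red_rel_tofrac.
Qed.

Lemma red_rel0 : red_rel 0 (0 : k).
Proof. by rewrite -(rmorph0 (@tofrac A)) -(rmorph0 red); apply: red_rel_tofrac. Qed.

(** A relation, as reduction is defined only on [p]-integral coefficients. *)
Definition red_poly (f : {poly F}) (fb : {poly k}) := forall i, red_rel f`_i fb`_i.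

Lemma red_polyD f g fb gb : red_poly f fb -> red_poly g gb ->
  red_poly (f + g) (fb + gb).
Proof. by move=> hf hg i; rewrite !coefD; apply: red_relD. Qed.

Lemma red_polyZ x y f fb : red_rel x y -> red_poly f fb -> red_poly (x *: f) (y *: fb).
Proof. by move=> hx hf i; rewrite !coefZ; apply: red_relM. Qed.

Lemma red_polyXn m : red_poly 'X^m 'X^m.
Proof.
move=> i; rewrite !coefXn -(rmorph_nat (@tofrac A)) -(rmorph_nat red).
exact: red_rel_tofrac.
Qed.

Lemma red_poly_lin (z : nat -> {poly F}) (zb : nat -> {poly k}) f fb :
  red_poly f fb -> (forall i, red_poly (z i) (zb i)) -> red_poly (lin z f) (lin zb fb).
Proof.
move=> hf hz.
rewrite (linE z (leq_maxl (size f) (size fb))) (linE zb (leq_maxr (size f) (size fb))).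
apply: (big_ind2 red_poly) => [i|f1 g1 f2 g2|i _]; first by rewrite !coef0; apply: red_rel0.
  exact: red_polyD.
exact: red_polyZ.
Qed.

Lemma red_poly_tmul f fb g gb : red_poly f fb -> red_poly g gb ->
  red_poly (tmul q f g) (tmul q fb gb).
Proof.
move=> hf hg; rewrite (tmulE constF) (tmulE constP).
apply: red_poly_lin => // i j; rewrite !coefMXn !coef_map /=.
case: ifP => _; first exact: red_rel0.
by apply: red_relX; apply: hg.
Qed.

Lemma red_poly1 : red_poly 1 1.
Proof. by have := red_polyXn 0; rewrite !expr0. Qed.

Lemma red_poly_dact g gb a : red_poly g gb ->
  red_poly (dact (@iotaF K) g a) (dact (@iotaP K p mi) gb a).
Proof.
move=> hg; apply: (big_ind2 red_poly) => [i|f1 g1 f2 g2|i _].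
- by rewrite !coef0; apply: red_rel0.
- exact: red_polyD.
apply: red_polyZ; first exact: red_rel_tofrac.
elim: (i : nat) => [|m IH]; first exact: red_poly1.
exact: red_poly_tmul.
Qed.

Lemma red_poly_qpoly f fb : red_poly f fb -> red_poly (qpoly_of q f) (qpoly_of q fb).
Proof. by move=> hf; rewrite !qpolyE; apply: (red_poly_lin hf) => i; apply: red_polyXn. Qed.

(** The factor [c] is a common denominator prime to [p], a product of denominators of the
    coefficients. *)
Lemma red_poly_denom f fb : red_poly f fb -> exists (c : A) (f' : {poly A}),
  [/\ ~~ (p %| c), map_poly (@tofrac A) f' = c%:F *: f & map_poly red f' = red c *: fb].
Proof.
have den m : (forall i, red_rel f`_i fb`_i) -> exists (c : A) (a : nat -> A),
   ~~ (p %| c) /\ forall i, (i < m)%N -> (a i)%:F = c%:F * f`_i.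
  move=> hf; elim: m => [|m [c [a [nc ha]]]].
    by exists 1, (fun=> 0); split=> //; rewrite -(red_eq0 mi) rmorph1 oner_eq0.
  have [a' [b' [nb' [e _]]]] := hf m.
  exists (c * b'), (fun i => if i == m then c * a' else a i * b').
  split; first by rewrite prime_dvdM negb_or nc.
  move=> i; rewrite ltnS leq_eqVlt; have [->|ne] /= := eqVneq i m.
    by move=> _; rewrite e !rmorphM -mulrA [_ / _]mulrC mulVKf ?not_dvd_neq0.
  by move/ha => e2; rewrite !rmorphM /= e2 mulrAC.
move=> hf; have [c [a [nc ha]]] := den (size f) hf.
have E : map_poly (@tofrac A) (\poly_(i < size f) a i) = c%:F *: f.
  apply/polyP => i; rewrite coef_map coef_poly coefZ /=.
  case: ltnP => h; first exact: ha.
  by rewrite nth_default // mulr0 rmorph0.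
exists c, (\poly_(i < size f) a i); split=> //.
apply/polyP => i; rewrite coef_map coefZ /=.
apply: (red_rel_uniq (x := c%:F * f`_i)).
  by rewrite -coefZ -E coef_map; apply: red_rel_tofrac.
by apply: red_relM => //; apply: red_rel_tofrac.
Qed.
End Reduction.

(** * Complete splitting and factorization modulo [p] *)

Section Monicization.
Variables (A : comNzRingType) (f : {poly A}) (l : A) (m : nat).
Hypotheses (sf : size f = m.+2) (lf : lead_coef f = l).

(* [l ^+ m * f(X)] as a polynomial in [l * X], where [f] has degree [m + 1]. *)
Definition monicize := \poly_(i < m.+2) (if i == m.+1 then 1 else f`_i * l ^+ (m - i)).

Lemma monicize_coef i : monicize`_i * l ^+ i = l ^+ m * f`_i.
Proof.
rewrite coef_poly; case: ltnP => [|h]; last first.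
  by rewrite mul0r nth_default ?sf // mulr0.
case: eqP => [->|/eqP ne lt].
  by rewrite mul1r exprSr -[X in _ * X]lf lead_coefE sf.
have le : (i <= m)%N by rewrite -ltnS ltn_neqAle ne -ltnS.
by rewrite -mulrA -exprD subnK // mulrC.
Qed.

Lemma monicize_monic : monicize \is monic.
Proof.
have E : monicize`_m.+1 = 1 by rewrite coef_poly ltnSn eqxx.
have s : size monicize = m.+2.
  apply/eqP; rewrite eqn_leq size_poly ltnNge; apply/negP => h.
  by move: E; rewrite nth_default // => /esym/eqP; rewrite oner_eq0.
by rewrite monicE lead_coefE s E.
Qed.
End Monicization.

(** The condition on coefficients says [h(aX) = c f(X)], so the roots of [h] are those of [f]
    multiplied by [a]. *)
Lemma eqp_scale_roots (R : fieldType) (f h : {poly R}) (a c : R) (zs : seq R) :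
  a != 0 -> c != 0 -> (forall i, h`_i * a ^+ i = c * f`_i) ->
  f %= \prod_(z <- zs) ('X - z%:P) ->
  h %= \prod_(z <- map ( *%R a) zs) ('X - z%:P).
Proof.
move=> a0 c0 hf /eqpf_eq [e e0 fE].
have scale_coef (u : {poly R}) i : (u \Po (a *: 'X))`_i = u`_i * a ^+ i.
  rewrite comp_polyE coef_sum.
  under eq_bigr => j _ do rewrite exprZn coefZ coefZ coefXn.
  have [le|lt] := leqP (size u) i.
    rewrite nth_default // mul0r big1 // => j _.
    by rewrite gtn_eqF ?mulr0 // (leq_trans _ le).
  rewrite (bigD1 (Ordinal lt)) //= eqxx mulr1 big1 ?addr0 // => j ne.
  by rewrite eq_sym [_ == _](negPf ne) !mulr0.
pose G := \prod_(z <- map ( *%R a) zs) ('X - z%:P).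
have GE : G \Po (a *: 'X) = a ^+ size zs *: \prod_(z <- zs) ('X - z%:P).
  rewrite /G big_map rmorph_prod; elim: zs {fE G} => [|z zs IH].
    by rewrite !big_nil expr0 scale1r.
  rewrite !big_cons IH /= comp_polyB comp_polyX comp_polyC.
  have -> : a *: 'X - (a * z)%:P = a *: ('X - z%:P).
    by rewrite polyCM mul_polyC scalerBr.
  by rewrite -scalerAl -scalerAr scalerA exprS.
have aX i : a ^+ i != 0 by rewrite expf_neq0.
suff -> : h = (c * e / a ^+ size zs) *: G.
  by rewrite eqp_scale // !mulf_neq0 ?invr_eq0.
apply/polyP => i; apply: (mulIf (aX i)); rewrite hf coefZ -[RHS]mulrA -scale_coef GE coefZ.
by rewrite fE coefZ !mulrA divfK.
Qed.

Section SplitsCompletely.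
Variables (K : finFieldType) (p : {poly K}) (mi : monic_irreducible_poly p).
Variable L : splittingFieldType {fraction {poly K}}.
Local Notation emb := (embA L).
Local Notation rd := (red mi).

(** Clearing denominators and scaling the roots by [l] replaces [f] by a monic [h] over [A]; [l] is
    a unit modulo [p], so the reduction of [h] splits with simple roots exactly when [fb] does. *)
Lemma splits_completely_iff (f : {poly {fraction {poly K}}}) (fb : {poly Fp mi}) m :
  red_poly f fb -> size f = m.+2 -> size fb = m.+2 ->
  separable_poly f -> separable_poly fb ->
  splittingFieldFor 1%VS (map_poly (in_alg L) f) fullv ->
  splits_completely L p <->
  exists2 ys, uniq ys & fb %= \prod_(y <- ys) ('X - y%:P).
Proof.
move=> hf sf sfb sepf sepfb [rs frs genL].
have [c [f' [nc hf' hfb']]] := red_poly_denom hf.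
have cF : c%:F != 0 :> {fraction {poly K}} by apply: not_dvd_neq0 nc.
have cr : rd c != 0 by rewrite red_eq0.
have sf' : size f' = m.+2.
  rewrite -sf -(size_scale f cF) -hf' size_map_inj_poly ?rmorph0 //.
  by move=> a e /eqP; rewrite tofrac_eq => /eqP.
pose l := lead_coef f'.
(* As [f] and [fb] have the same degree, the leading coefficient stays nonzero modulo [p]. *)
have lr : rd l != 0.
  have -> : rd l = rd c * fb`_m.+1.
    by rewrite -coefZ -hfb' coef_map /l lead_coefE sf'.
  by rewrite mulf_neq0 // -[m.+1]/(m.+2.-1) -sfb -lead_coefE lead_coef_eq0 -size_poly_eq0 sfb.
have l0 : l != 0 by apply: contraNneq lr => ->; rewrite rmorph0.
have le : emb l != 0 by rewrite -(rmorph0 emb) (inj_eq (@emb_inj K L)).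
have ce : emb c != 0.
  rewrite -(rmorph0 emb) (inj_eq (@emb_inj K L)).
  by apply: contraNneq cr => ->; rewrite rmorph0.
pose h := monicize f' l m.
have mh : h \is monic by apply: monicize_monic.
have hE : forall i, h`_i * l ^+ i = l ^+ m * f'`_i by move=> i; apply: monicize_coef.
have hL i : (map_poly emb h)`_i * emb l ^+ i = emb l ^+ m * emb c * (map_poly (in_alg L) f)`_i.
  rewrite coef_map -rmorphXn -rmorphM hE rmorphM rmorphXn /= -mulrA; congr (_ * _).
  have := congr1 (fun g : {poly _} => in_alg L g`_i) hf'.
  by rewrite coef_map coefZ rmorphM /= coef_map.
have hk i : (map_poly rd h)`_i * rd l ^+ i = rd l ^+ m * rd c * fb`_i.
  rewrite coef_map -rmorphXn -rmorphM hE rmorphM rmorphXn /= -mulrA; congr (_ * _).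
  by rewrite -coefZ -hfb' coef_map.
pose zs := map ( *%R (emb l)) rs.
have h_zs : map_poly emb h = \prod_(z <- zs) ('X - z%:P).
  apply/eqP; rewrite -eqp_monic ?monic_map ?monic_prod_XsubC //.
  by apply: (eqp_scale_roots le _ hL frs); rewrite mulf_neq0 ?expf_neq0.
have zs_uniq : uniq zs.
  rewrite map_inj_uniq; last exact: mulfI.
  by rewrite -separable_prod_XsubC -(eqp_separable frs) separable_map.
have zs_gen : <<1 & zs>>%VS = fullv.
  apply/eqP; rewrite eqEsubv subvf -genL; apply/Fadjoin_seqP; split.
    exact: sub1v.
  move=> z zrs; have : emb l * z \in <<1 & zs>>%VS.
    by apply: seqv_sub_adjoin; apply: map_f.
  rewrite -[X in _ -> X]/(is_true _) -{2}(mulKf le z) => h1.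
  apply: rpredM h1; rewrite rpredV; apply: (subvP (subv_adjoin_seq _ _)).
  exact: rpredZ (mem1v _).
split=> [sp|[ys uys fbys] P prP Pp].
  (* Complete splitting quantifies over the primes above [p]; one of them must be exhibited to use
     it. *)
  have [P [prP Pp]] := prime_ideal_exists L mi.
  have [res _] := sp P prP Pp.
  have int_zs z : z \in zs -> intA z.
    by rewrite -root_prod_XsubC -h_zs; exists h.
  have [rho hrho] : exists rho : L -> Fp mi, forall z, z \in zs -> reduces P z (rho z).
    apply: (seq_choice (R := fun z (y : Fp mi) => reduces P z y) 0) => z zz.
    by have [a Pa] := res z (int_zs z zz); exists (rd a), a.
  have h_rho := reduces_roots prP Pp hrho h_zs.
  have fb_rho : fb %= \prod_(y <- map ( *%R (rd l)^-1) (map rho zs)) ('X - y%:P).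
    apply: (@eqp_scale_roots _ (map_poly rd h) _ _ (rd l ^+ m * rd c)^-1).
    - by rewrite invr_eq0.
    - by rewrite invr_eq0 mulf_neq0 ?expf_neq0.
    - move=> i; have lX : rd l ^+ i != 0 by rewrite expf_neq0.
      apply: (mulIf lX); rewrite -[RHS]mulrA hk exprVn mulfVK //.
      by rewrite mulKf // mulf_neq0 ?expf_neq0.
    by rewrite h_rho [X in _ %= X]big_map; apply: eqpxx.
  exists (map ( *%R (rd l)^-1) (map rho zs)) => //.
  by rewrite -separable_prod_XsubC -(eqp_separable fb_rho).
have h_ys : map_poly rd h = \prod_(y <- map ( *%R (rd l)) ys) ('X - y%:P).
  apply/eqP; rewrite -eqp_monic ?monic_map ?monic_prod_XsubC //.
  by apply: (eqp_scale_roots lr _ hk fbys); rewrite mulf_neq0 ?expf_neq0.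
have uys' : uniq (map ( *%R (rd l)) ys) by rewrite map_inj_uniq //; apply: mulfI.
split; first by move=> x; apply: (residue_degree1 mh zs_uniq h_zs zs_gen uys' h_ys prP Pp).
exact: (unramified mh zs_uniq h_zs zs_gen uys' h_ys prP Pp).
Qed.
End SplitsCompletely.

Lemma horner_map_polyC (K : finFieldType) (R : comNzRingType)
    (s : {rmorphism {poly K} -> R}) (a : {poly K}) :
  (map_poly (s \o polyC) a).[s 'X] = s a.
Proof.
elim/poly_ind: a => [|a c IH]; first by rewrite !rmorph0 horner0.
rewrite rmorphD rmorphM /= map_polyX map_polyC hornerMXaddC IH.
by rewrite rmorphD rmorphM.
Qed.

(** * The reduction of [phi] at a prime of good reduction *)

Section Main.
Variables (K : finFieldType) (r' : nat) (g : {poly {fraction {poly K}}}).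
Local Notation r := r'.+1.
Hypotheses (r0 : (0 < r')%N) (hsize : size g = r.+1).
Hypothesis hT : g`_0 = ('X : {poly K})%:F.
Hypothesis hchar : forall l : nat, l \in [pchar K] -> ~~ (l %| r)%N.
Variables (n p : {poly K}) (mi : monic_irreducible_poly p).
Hypotheses (n0 : n != 0) (hgood : good_prime p g r) (hpn : ~~ (p %| n)).
Variable gbar : {poly Fp mi}.
Hypothesis hgbar : forall i, red_rel g`_i gbar`_i.

Local Notation ck := (constP mi).
Local Notation S := (skewpoly ck).
Local Notation gb := (gbar : S).
Local Notation d := (size p).-1.

(** The leading coefficient of [g] is a unit at [p], so it does not reduce to 0. *)
Lemma size_gbar : size gbar = r.+1.
Proof.
apply/eqP; rewrite eqn_leq; apply/andP; split.
  apply/leq_sizeP => j lej; apply: (red_rel_uniq (hgbar j)).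
  by rewrite nth_default ?hsize //; apply: red_rel0.
rewrite ltnNge; apply/negP => le.
case: hgood => _ [a [b [na [nb e]]]].
have := hgbar r; rewrite (nth_default _ le) => h0.
have ha : red_rel (g`_r * b%:F) (0 * red mi b) by apply: red_relM => //; apply: red_rel_tofrac.
move: ha; rewrite e divfK ?(not_dvd_neq0 nb) // mul0r.
move=> /red_rel_uniq /(_ (red_rel_tofrac mi a)).
by move/esym/eqP; rewrite red_eq0 (negPf na).
Qed.

Lemma gbar0 : gbar`_0 = red mi 'X.
Proof. by apply: (red_rel_uniq (hgbar 0)); rewrite hT; apply: red_rel_tofrac. Qed.

Lemma card_Fp : #|Fp mi| = (#|K| ^ d)%N.
Proof. exact: card_qfpoly. Qed.

Lemma degree_gt0 : (0 < d)%N.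
Proof. by case: mi => [[sp _] _]; case: (size p) sp => [|[]]. Qed.

Lemma char_gbar (a : {poly K}) : a != 0 -> (map_poly ck a).[gbar`_0] = 0 -> (d < size a)%N.
Proof.
move=> a0; rewrite gbar0 horner_map_polyC => /eqP; rewrite red_eq0 => /(dvdp_leq a0).
by apply: leq_trans; have := degree_gt0; case: (size p).
Qed.

Local Notation cpi := (comm_pi gb card_Fp).
Local Notation pi := (tau ck d).

Lemma in_End_comm (u : S) : in_End gbar u <-> GRing.comm gb u.
Proof.
split=> [h|cu a]; last by have := comm_phi a cu; rewrite phiE.
by have := h 'X; rewrite -(phiE gb) phi_X.
Qed.

Lemma eval_pi_ev Q : eval_pi gbar Q = ev cpi Q.
Proof.
rewrite (evE size_gbar); apply: eq_bigr => i _.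
by rewrite -(phiE gb) skewX.
Qed.

Lemma coef0_phi_bar : (phi gb n : {poly Fp mi})`_0 != 0.
Proof. by rewrite coef0_phi gbar0 horner_map_polyC red_eq0. Qed.

(** Since [p] does not divide [n], the polynomial [phi_n(x)] is separable both over [F] and modulo
    [p], with the same degree; its splitting over [k] is right divisibility of [pi - 1] by
    [phi n]. *)
Lemma splits_completely_Frobenius (L : splittingFieldType {fraction {poly K}}) :
  splittingFieldFor 1%VS (map_poly (in_alg L) (phi_poly g n)) fullv ->
  splits_completely L p <->
  exists2 u : S, GRing.comm gb u & pi = 1 + phi gb n * u.
Proof.
move=> hL; pose gF : skewpoly (@constF K) := g.
have fE : phi_poly g n = qpoly_of #|K| (phi gF n) by rewrite phiE.
have sq (R : fieldType) (i : {rmorphism K -> R}) (x : skewpoly i) :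
    size (x : {poly R}) = r.+1 ->
    size (qpoly_of #|K| (phi x n)) = (#|K| ^ (r * (size n).-1)).-1.+2.
  move=> sx; have s1 := size_phi sx isT n0.
  by rewrite size_qpoly ?s1 ?prednK ?expq_gt0 // -size_poly_eq0 s1.
have hrf : red_poly (phi_poly g n) (qpoly_of #|K| (phi gb n)).
  by apply: red_poly_qpoly; rewrite phiE; apply: red_poly_dact.
have sepF : separable_poly (phi_poly g n).
  rewrite fE; apply: (qpoly_separable (@constF K)).
  by rewrite coef0_phi hT horner_map_polyC tofrac_eq0.
have sepk := qpoly_separable ck coef0_phi_bar.
have := splits_completely_iff hrf _ (sq _ _ gb size_gbar) sepF sepk hL.
rewrite {1}fE => /(_ (sq _ _ gF hsize)) ->.
have pn0 := phi_n0 (iota := ck) size_gbar n0.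
have piE (u : S) : pi = 1 + u <-> ('X^d - 1 : {poly Fp mi}) = u.
  split=> [e|<-]; last by rewrite [RHS]addrC subrK.
  by rewrite -[LHS]/(pi - 1) e addrAC subrr add0r.
split=> [[ys uys hys]|[u cu /piE e]].
  have [u e] := Frobenius_factor card_Fp pn0 uys hys.
  (* Both [u * phi n = pi - 1] and [phi n] commute with [g]; cancelling [phi n] on the right leaves
     [u]. *)
  have cu : GRing.comm gb u.
    have h : gb * (u * phi gb n) = u * phi gb n * gb.
      have : GRing.comm gb (pi - 1) by apply: commrB; [exact: cpi | exact: commr1].
      by rewrite -e.
    apply: (skew_mulIr pn0); rewrite /= -mulrA h -!mulrA; congr (u * _).
    exact/esym/phi_comm.
  by exists u => //; apply/piE; rewrite e (comm_phi n cu).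
by apply: (Frobenius_factor_split card_Fp (u := u)); rewrite e (comm_phi n cu).
Qed.

Variables (P : {poly {poly K}}) (b : nat -> {poly K}).
Hypotheses (hP : is_minpoly_pi gbar P) (hb : refined_index gbar r b).

Lemma Frobenius_refined_index :
  (exists2 u : S, GRing.comm gb u & pi = 1 + phi gb n * u) <->
  (n %| P`_r' + r%:R) /\ (n %| b 0%N).
Proof.
have [monP evP minP] := hP; rewrite eval_pi_ev in evP.
have {}minP Q : Q != 0 -> ev cpi Q = 0 -> (size P <= size Q)%N.
  by rewrite -eval_pi_ev; apply: minP.
have [monb dvdb [f [fD fZ f_onto f_ker]]] := hb.
have fD' (u v : S) i : GRing.comm gb u -> GRing.comm gb v -> (i < r')%N ->
    b i %| f (u + v) i - (f u i + f v i).
  by move=> /in_End_comm hu /in_End_comm hv; apply: fD.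
have fZ' a (u : S) i : GRing.comm gb u -> (i < r')%N ->
    b i %| f (phi gb a * u) i - a * f u i.
  by move=> /in_End_comm hu; rewrite phiE; apply: fZ.
have f_onto' (c : nat -> {poly K}) : exists2 u : S, GRing.comm gb u &
    forall i, (i < r')%N -> b i %| f u i - c i.
  by have [u /in_End_comm cu hu] := f_onto c; exists u.
have f_ker' (u : S) : GRing.comm gb u ->
    ((forall i, (i < r')%N -> b i %| f u i) <-> exists Q, u = ev cpi Q).
  move=> /in_End_comm /f_ker ->.
  by split=> -[Q e]; exists Q; rewrite e eval_pi_ev.
split=> [[u cu e]|[nP nb]].
  split; last exact: (refined_index_dvd size_gbar degree_gt0 char_gbar monP evP
                        minP fD' fZ' f_ker' n0 r0 cu e).
  (* The first congruence is the trace relation for [a = 1]. *)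
  have e1 : pi = phi gb 1 + phi gb n * u by rewrite rmorph1.
  have := minpoly_trace size_gbar degree_gt0 char_gbar monP evP minP cu e1.
  by rewrite mulr1.
have rK : r%:R != 0 :> K.
  apply/negP => rK; have [l ch] := natf0_pchar (isT : (0 < r)%N) rK.
  have nl := hchar ch; rewrite (dvdn_pcharf ch) in nl.
  by rewrite rK in nl.
exact: (refined_index_root size_gbar degree_gt0 char_gbar monP evP minP monb dvdb
          fD' fZ' f_onto' f_ker' n0 r0 rK nP nb).
Qed.
End Main.

(** Transfers a property from [splittingFieldType], on which the Galois theory is developed, to a
    bare extension; the repacked structure becomes identical to [L] once [L] is destructed. *)
Lemma splittingFieldType_ind (F : fieldType) (C : fieldExtType F -> Prop) :
  (forall L : splittingFieldType F, C L) ->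
  forall L : fieldExtType F, splitting_field_axiom L -> C L.
Proof.
move=> hC L ax; pose L' : splittingFieldType F :=
  HB.pack (L : Type) L (FieldExt_isSplittingField.Build F L ax).
suff <- : (L' : fieldExtType F) = L by apply: hC.
by rewrite {}/L'; case: L ax => T [].
Qed.

Theorem theorem1p2 (K : finFieldType) (r : nat)
  (g : {poly {fraction {poly K}}})
  (hr : (2 <= r)%N) (hsize : size g = r.+1)
  (hT : g`_0 = ('X : {poly K})%:F)
  (hchar : forall l : nat, l \in [pchar K] -> ~~ (l %| r)%N)
  (n : {poly K}) (hn : n != 0)
  (p : {poly K}) (mi : monic_irreducible_poly p)
  (hgood : good_prime p g r) (hpn : ~~ (p %| n))
  (L : fieldExtType {fraction {poly K}})
  (hL : splittingFieldFor 1%VS (map_poly (in_alg L) (phi_poly g n)) fullv)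
  (gbar : {poly Fp mi}) (hgbar : forall i, red_rel g`_i gbar`_i)
  (P : {poly {poly K}}) (hP : is_minpoly_pi gbar P)
  (b : nat -> {poly K}) (hb : refined_index gbar r b) :
  splits_completely L p <-> (n %| P`_(r.-1) + r%:R) /\ (n %| b 0%N).
Proof.
case: r hr hsize hchar hgood hb => // r' hr hsize hchar hgood hb.
(* Both sides are compared with condition (C). *)
apply: iff_trans (Frobenius_refined_index hr hsize hT hchar hn hgood hgbar hP hb).
move: (hL); apply: (splittingFieldType_ind (C := fun L => splittingFieldFor 1%VS
  (map_poly (in_alg L) (phi_poly g n)) fullv -> splits_completely L p <-> _)).
  by move=> L'; apply: (splits_completely_Frobenius hsize hT hn hgood hpn hgbar).
exists (map_poly (in_alg L) (phi_poly g n)) => //.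
by apply/polyOverP => i; rewrite coef_map /=; apply: rpredZ (mem1v _).
Qed.
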